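(* For the quantum group $\mathfrak{D}$ at $\mathbb{S}_3$ attached to the 12-dimensional Fomin–Kirillov algebra, the socle of the Verma module $\mathsf{M}(\sigma,-)$ is $$\mathsf{S}(\sigma,-)=\mathsf{M}_{\mathsf{soc}}\oplus\mathsf{N}_1\oplus\mathsf{N}_2\oplus\mathsf{R},$$ where $\mathsf{M}_{\mathsf{soc}}\simeq M(\sigma,-)\simeq\mathsf{R}$ and $\mathsf{N}_\ell\simeq M(\tau,\ell)$, $\ell=1,2$, as $\mathfrak{D}(\mathbb{S}_3)$-modules. Here $\mathsf{M}_{\mathsf{soc}}=\mathfrak{B}^4(V)\otimes M(\sigma,-)$, and $\mathsf{N}_\ell$ and $\mathsf{R}$ are the $\mathfrak{D}(\mathbb{S}_3)$-submodules of $\mathsf{M}(\sigma,-)$ generated respectively by $$\mathsf{n}_\ell=\zeta^\ell x_{(13)}x_{(12)}x_{(23)}|23\rangle+\zeta^{-\ell}x_{(12)}x_{(13)}x_{(23)}|12\rangle-x_{(12)}x_{(13)}x_{(12)}|13\rangle,$$ $$\mathsf{r}=-(x_{(12)}x_{(13)}+x_{(13)}x_{(23)})|12\rangle-(x_{(12)}x_{(23)}+x_{(13)}x_{(12)})|13\rangle.$$ Moreover, $\mathsf{S}(\sigma,-)$ is a highest-weight module of weight $(\sigma,-)$ and therefore $\mathsf{S}(\sigma,-)\simeq\mathsf{L}(\sigma,-)$.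
   Context: $\Bbbk$ is an algebraically closed field of characteristic zero, $\zeta\in\Bbbk$ a fixed primitive cube root of $1$; $\sigma=(12)$, $\tau=(123)$ in $\mathbb{S}_3$, permutations composed right to left, so $\sigma\tau=(23)$, $\sigma\tau^2=(13)$. $V=\Bbbk\{x_{(12)},x_{(23)},x_{(13)}\}$ is the Yetter–Drinfeld module over $\Bbbk\mathbb{S}_3$ with $g\cdot x_{(ij)}=\mathrm{sgn}(g)x_{g(ij)g^{-1}}$ and coaction $x_{(ij)}\mapsto(ij)\otimes x_{(ij)}$. Its Nichols algebra $\mathfrak{B}(V)=\bigoplus_{n=0}^4\mathfrak{B}^n(V)$ is the 12-dimensional Fomin–Kirillov algebra. $\mathfrak{D}$ is the Drinfeld double of the bosonization $\mathfrak{B}(V)\#\Bbbk\mathbb{S}_3$. Explicitly, $\mathfrak{D}$ is the algebra generated by $x_{(ij)}$, $y_{(ij)}$ (transpositions $(ij)$) and $g,\delta_g$ ($g\in\mathbb{S}_3$), where the $g$ multiply as in $\mathbb{S}_3$, the $\delta_g$ are orthogonal idempotents with sum $1$, and, for distinct $i,j,k$ and $g,h\in\mathbb{S}_3$: $x_{(ij)}^2=0$, $x_{(ij)}x_{(ik)}+x_{(jk)}x_{(ij)}+x_{(ik)}x_{(jk)}=0$; the same relations for the $y$'s; $\delta_hg=g\delta_{g^{-1}hg}$; $gx_{(ij)}=\mathrm{sgn}(g)x_{g(ij)g^{-1}}g$; $\delta_hx_{(ij)}=x_{(ij)}\delta_{(ij)h}$; $\delta_gy_{(ij)}=y_{(ij)}\delta_{(ij)g}$;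 $y_{(ij)}g=\mathrm{sgn}(g)\,g\,y_{g^{-1}(ij)g}$; $y_{(ij)}x_{(ij)}+x_{(ij)}y_{(ij)}=1+(ij)(\delta_{(ij)}-\delta_e)$; $y_{(ik)}x_{(ij)}+x_{(ij)}y_{(jk)}=(ij)(\delta_{(ik)}-\delta_{(ik)(ij)})$. The $g,\delta_g$ generate the Drinfeld double $\mathfrak{D}(\mathbb{S}_3)$ of $\Bbbk\mathbb{S}_3$; $\overline V=\Bbbk\{y_{(ij)}\}$ generates $\mathfrak{B}(\overline V)$; multiplication $\mathfrak{B}(V)\otimes\mathfrak{D}(\mathbb{S}_3)\otimes\mathfrak{B}(\overline V)\to\mathfrak{D}$ is a linear isomorphism. Simple $\mathfrak{D}(\mathbb{S}_3)$-modules relevant here (''degree $h$'' means $\delta_h$ acts as identity and other $\delta$'s by $0$): $M(\sigma,-)$ with basis $|12\rangle,|23\rangle,|13\rangle$, $|ij\rangle$ of degree $(ij)$, $g|ij\rangle=\mathrm{sgn}(g)|g(ij)g^{-1}\rangle$; $M(\tau,\ell)$ with basis $|\tau\rangle,|\tau^{-1}\rangle$, $|\tau^{\pm1}\rangle$ of degree $\tau^{\pm1}$, $\tau^t|\tau^{\pm1}\rangle=\zeta^{\pm t\ell}|\tau^{\pm1}\rangle$, $\sigma\tau^t|\tau^{\pm1}\rangle=\zeta^{\pm t\ell}|\tau^{\mp1}\rangle$. A $\mathfrak{D}(\mathbb{S}_3)$-module is of weight $(g,\varrho)$ if it is isomorphic to $M(g,\varrho)$. Let $\mathfrak{D}^{\ge0}$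 be the subalgebra generated by $\mathfrak{D}(\mathbb{S}_3)$ and $\overline V$; a simple $\mathfrak{D}(\mathbb{S}_3)$-module $M(g,\varrho)$ is a $\mathfrak{D}^{\ge0}$-module with $\overline V$ acting by $0$. The Verma module is $\mathsf{M}(g,\varrho)=\mathfrak{D}\otimes_{\mathfrak{D}^{\ge0}}M(g,\varrho)=\mathfrak{B}(V)\otimes M(g,\varrho)$; write $x|h\rangle$ for $x\otimes|h\rangle$. It has a unique maximal $\mathfrak{D}$-submodule; $\mathsf{L}(g,\varrho)$ is its head and $\mathsf{S}(g,\varrho)$ its socle. A $\mathfrak{D}$-module is a highest-weight module of weight $(g,\varrho)$ if it is generated by a $\mathfrak{D}(\mathbb{S}_3)$-submodule $M$ of weight $(g,\varrho)$ with $\overline VM=0$. *)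

(* Defs.v *)
From HB Require Import structures.
From mathcomp Require Import all_boot all_order all_algebra all_fingroup.
From mathcomp Require Import generic_quotient ring_quotient.
From mathcomp Require Import boolp classical_sets.
From mathcomp.multinomials Require Import monalg.

Set Implicit Arguments.
Unset Strict Implicit.
Unset Printing Implicit Defensive.

Import GRing.Theory Quotient.
Local Open Scope classical_set_scope.
Local Open Scope quotient_scope.
Local Open Scope ring_scope.

Section Closures.
Variables (A : pzRingType) (V : lmodType A).

(* The subsets of V that are stable under addition and under the action of the
   elements of K.  Every K used below contains -1. *)
Definition submod (K : set A) (N : set V) : Prop :=
  [/\ N 0, forall u v, N u -> N v -> N (u + v)
    & forall a u, K a -> N u -> N (a *: u)].

Definition genmod (K : set A) (G : set V) : set V := smallest (submod K) G.

Lemma submod_genmod K G : submod K (genmod K G).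
Proof.
split=> [N [[N0 _ _]] //|u v Nu Nv N hN|a u Ka Nu N hN].
  by case: (hN) => -[_ ND _] _; apply: ND; [apply: Nu|apply: Nv].
by case: (hN) => -[_ _ NZ] _; apply: NZ => //; apply: Nu.
Qed.

End Closures.

Section LmodQuotient.
Variables (A : pzRingType) (V : lmodType A) (G : set V).

Definition genmodb : {pred V} := fun v => `[< genmod setT G v >].

Lemma genmodb_zmod_closed : zmod_closed genmodb.
Proof.
have [N0 ND NZ] := submod_genmod setT G.
split=> [|u v]; rewrite !unfold_in; first exact/asboolP.
move=> /asboolP Nu /asboolP Nv; apply/asboolP.
by rewrite -scaleN1r; apply: ND => //; apply: NZ.
Qed.

HB.instance Definition _ := GRing.isZmodClosed.Build V genmodb
  genmodb_zmod_closed.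

(* V modulo the A-submodule generated by G *)
Definition lquot := {quot genmodb}.
HB.instance Definition _ := GRing.Zmodule.on lquot.

Definition lpi (v : V) : lquot := \pi_({quot genmodb}) v.

Lemma lpiP u v : lpi u = lpi v <-> genmod setT G (u - v).
Proof.
rewrite /lpi; split=> [/eqP|h]; last apply/eqP.
  by rewrite -Quotient.idealrBE unfold_in => /asboolP.
by rewrite -Quotient.idealrBE unfold_in; apply/asboolP.
Qed.

Lemma lpiD u v : lpi (u + v) = lpi u + lpi v.
Proof. by rewrite /lpi (raddfD \pi_({quot genmodb})). Qed.

Definition lquot_scale (a : A) (q : lquot) : lquot :=
  lpi (a *: (repr (q : {quot genmodb}))).

Lemma lquot_scaleE a v : lquot_scale a (lpi v) = lpi (a *: v).
Proof.
rewrite /lquot_scale; apply/lpiP; rewrite -scalerBr.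
have [_ _ NZ] := submod_genmod setT G; apply: NZ => //.
by apply/lpiP; rewrite /lpi reprK.
Qed.

Lemma lpi_surj (q : lquot) : exists v, q = lpi v.
Proof. by exists (repr (q : {quot genmodb})); rewrite /lpi reprK. Qed.

Fact lquot_scaleA a b q :
  lquot_scale a (lquot_scale b q) = lquot_scale (a * b) q.
Proof. by have [v ->] := lpi_surj q; rewrite !lquot_scaleE scalerA. Qed.
Fact lquot_scale1 : left_id 1 lquot_scale.
Proof. by move=> q; have [v ->] := lpi_surj q; rewrite lquot_scaleE scale1r. Qed.
Fact lquot_scaleDr : right_distributive lquot_scale +%R.
Proof.
move=> a q q'; have [v ->] := lpi_surj q; have [w ->] := lpi_surj q'.
by rewrite -lpiD !lquot_scaleE scalerDr lpiD.
Qed.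
Fact lquot_scaleDl q : {morph lquot_scale^~ q : a b / a + b}.
Proof.
by move=> a b; have [v ->] := lpi_surj q; rewrite !lquot_scaleE scalerDl lpiD.
Qed.
HB.instance Definition _ := GRing.Zmodule_isLmodule.Build A lquot
  lquot_scaleA lquot_scale1 lquot_scaleDr lquot_scaleDl.

Lemma lpiZ a v : lpi (a *: v) = a *: lpi v.
Proof. by rewrite -lquot_scaleE. Qed.

End LmodQuotient.

Section AlgQuotient.
Variables (R : comNzRingType) (F : lalgType R).
Hypothesis scaleFr : forall (c : R) (x y : F), c *: (x * y) = x * (c *: y).
Variable rel : F -> F -> Prop.

Definition two_sided (N : set F) : Prop :=
  [/\ N 0, forall u v, N u -> N v -> N (u + v)
    & forall a u b, N u -> N (a * u * b)].

Definition relset : set F := [set u | exists a b, rel a b /\ u = a - b].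
Definition genideal : set F := smallest two_sided relset.
Definition genidealb : {pred F} := fun v => `[< genideal v >].

Lemma two_sided_genideal : two_sided genideal.
Proof.
split=> [N [[N0 _ _]] //|u v Nu Nv N hN|a u b Nu N hN].
  by case: (hN) => -[_ ND _] _; apply: ND; [apply: Nu|apply: Nv].
by case: (hN) => -[_ _ NZ] _; apply: NZ => //; apply: Nu.
Qed.

Lemma genidealb_zmod_closed : zmod_closed genidealb.
Proof.
have [N0 ND NZ] := two_sided_genideal.
split=> [|u v]; rewrite !unfold_in; first exact/asboolP.
move=> /asboolP Nu /asboolP Nv; apply/asboolP.
by apply: ND => //; have := NZ (-1) v 1 Nv; rewrite mulN1r mulr1.
Qed.

HB.instance Definition _ := GRing.isZmodClosed.Build F genidealb
  genidealb_zmod_closed.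

(* F modulo the two-sided ideal generated by the a - b with rel a b *)
Definition aquot := {quot genidealb}.
HB.instance Definition _ := GRing.Zmodule.on aquot.

Definition api (v : F) : aquot := \pi_({quot genidealb}) v.

Lemma apiP u v : api u = api v <-> genideal (u - v).
Proof.
rewrite /api; split=> [/eqP|h]; last apply/eqP.
  by rewrite -Quotient.idealrBE unfold_in => /asboolP.
by rewrite -Quotient.idealrBE unfold_in; apply/asboolP.
Qed.

Lemma api_rel u v : rel u v -> api u = api v.
Proof. by move=> h; apply/apiP => N [_]; apply; exists u, v. Qed.

Lemma apiD u v : api (u + v) = api u + api v.
Proof. by rewrite /api (raddfD \pi_({quot genidealb})). Qed.

Lemma api0 : api 0 = 0.
Proof. by rewrite /api (raddf0 \pi_({quot genidealb})). Qed.

Lemma api_surj (q : aquot) : exists v, q = api v.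
Proof. by exists (repr (q : {quot genidealb})); rewrite /api reprK. Qed.

Let arepr (q : aquot) : F := repr (q : {quot genidealb}).
Let areprK q : api (arepr q) = q. Proof. by rewrite /api reprK. Qed.

Definition aquot_mul (q q' : aquot) : aquot := api (arepr q * arepr q').
Definition aquot_scale (c : R) (q : aquot) : aquot := api (c *: arepr q).

Lemma aquot_mulE u v : aquot_mul (api u) (api v) = api (u * v).
Proof.
have [_ ND NZ] := two_sided_genideal.
rewrite /aquot_mul; apply/apiP.
have -> : arepr (api u) * arepr (api v) - u * v
  = 1 * (arepr (api u) - u) * arepr (api v) + u * (arepr (api v) - v) * 1.
  by rewrite mul1r mulr1 mulrBl mulrBr addrA subrK.
by apply: ND; apply: NZ; apply/apiP; rewrite areprK.
Qed.

Lemma aquot_scaleE c v : aquot_scale c (api v) = api (c *: v).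
Proof.
have [_ _ NZ] := two_sided_genideal.
rewrite /aquot_scale; apply/apiP; rewrite -scalerBr.
have -> : c *: (arepr (api v) - v) = c%:A * (arepr (api v) - v) * 1.
  by rewrite mulr1 -scalerAl mul1r.
by apply: NZ; apply/apiP; rewrite areprK.
Qed.

Fact aquot_mulA : associative aquot_mul.
Proof.
move=> q1 q2 q3; have [u ->] := api_surj q1; have [v ->] := api_surj q2.
by have [w ->] := api_surj q3; rewrite !aquot_mulE mulrA.
Qed.
Fact aquot_mul1l : left_id (api 1) aquot_mul.
Proof. by move=> q; have [u ->] := api_surj q; rewrite aquot_mulE mul1r. Qed.
Fact aquot_mul1r : right_id (api 1) aquot_mul.
Proof. by move=> q; have [u ->] := api_surj q; rewrite aquot_mulE mulr1. Qed.
Fact aquot_mulDl : left_distributive aquot_mul +%R.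
Proof.
move=> q1 q2 q3; have [u ->] := api_surj q1; have [v ->] := api_surj q2.
by have [w ->] := api_surj q3; rewrite -apiD !aquot_mulE mulrDl apiD.
Qed.
Fact aquot_mulDr : right_distributive aquot_mul +%R.
Proof.
move=> q1 q2 q3; have [u ->] := api_surj q1; have [v ->] := api_surj q2.
by have [w ->] := api_surj q3; rewrite -apiD !aquot_mulE mulrDr apiD.
Qed.
HB.instance Definition _ := GRing.Zmodule_isPzRing.Build aquot
  aquot_mulA aquot_mul1l aquot_mul1r aquot_mulDl aquot_mulDr.

Fact aquot_scaleA a b q :
  aquot_scale a (aquot_scale b q) = aquot_scale (a * b) q.
Proof. by have [v ->] := api_surj q; rewrite !aquot_scaleE scalerA. Qed.
Fact aquot_scale1 : left_id 1 aquot_scale.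
Proof. by move=> q; have [v ->] := api_surj q; rewrite aquot_scaleE scale1r. Qed.
Fact aquot_scaleDr : right_distributive aquot_scale +%R.
Proof.
move=> a q q'; have [v ->] := api_surj q; have [w ->] := api_surj q'.
by rewrite -apiD !aquot_scaleE scalerDr apiD.
Qed.
Fact aquot_scaleDl q : {morph aquot_scale^~ q : a b / a + b}.
Proof.
by move=> a b; have [v ->] := api_surj q; rewrite !aquot_scaleE scalerDl apiD.
Qed.
HB.instance Definition _ := GRing.Zmodule_isLmodule.Build R aquot
  aquot_scaleA aquot_scale1 aquot_scaleDr aquot_scaleDl.

Lemma apiM u v : api (u * v) = api u * api v.
Proof. exact/esym/aquot_mulE. Qed.
Lemma api1 : api 1 = 1.
Proof. by []. Qed.
Lemma apiZ c v : api (c *: v) = c *: api v.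
Proof. exact/esym/aquot_scaleE. Qed.

Lemma aquot_scaleAl (c : R) (p q : aquot) : c *: (p * q) = (c *: p) * q.
Proof.
have [u ->] := api_surj p; have [v ->] := api_surj q.
by rewrite -apiM -!apiZ -apiM scalerAl.
Qed.
Lemma aquot_scaleAr (c : R) (p q : aquot) : c *: (p * q) = p * (c *: q).
Proof.
have [u ->] := api_surj p; have [v ->] := api_surj q.
by rewrite -apiM -!apiZ -apiM scaleFr.
Qed.

End AlgQuotient.

Lemma malg_scaleAr (k : comNzRingType) (K : monomType) (c : k)
  (x y : {malg k[K]}) : c *: (x * y) = x * (c *: y).
Proof.
rewrite -!mul_malgC !mulrA; congr (_ * _).
rewrite !malgM_def fgmulUg fgmulgU; apply: eq_bigr => m _.
by rewrite mul1m mulm1 mulrC.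
Qed.

(* The points 1, 2, 3 are 0, 1, 2 : 'I_3.  The product (g * h)%g of 'S_3 applies
   g first, whereas the formulas below are for permutations composed right to
   left, that is for [comp3].  For that product g t g^-1 is (t ^ g)%g and
   g^-1 t g is (t ^ g^-1)%g. *)
Definition comp3 (g h : 'S_3) : 'S_3 := (h * g)%g.

Lemma conj3E g t : (t ^ g)%g = comp3 (comp3 g t) g^-1.
Proof. by rewrite /comp3 conjgE. Qed.

Definition p1 : 'I_3 := @Ordinal 3 0 isT.
Definition p2 : 'I_3 := @Ordinal 3 1 isT.
Definition p3 : 'I_3 := @Ordinal 3 2 isT.

Definition sigma : 'S_3 := tperm p1 p2.
Definition tau : 'S_3 := comp3 (tperm p1 p2) (tperm p2 p3).

Lemma tauE : [/\ tau p1 = p2, tau p2 = p3 & tau p3 = p1].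
Proof. by split; rewrite permM !permE. Qed.

Lemma sigma_tau : comp3 sigma tau = tperm p2 p3.
Proof. by rewrite /comp3 -mulgA tperm2 mulg1. Qed.

(* The odd permutations of three points are exactly the transpositions. *)
Definition transp := {t : 'S_3 | odd_perm t}.

Fact odd_sigma : odd_perm sigma.
Proof. by rewrite odd_tperm. Qed.

Definition tsigma : transp := exist _ sigma odd_sigma.

(* (ij), with a dummy value if i = j *)
Definition tr (i j : 'I_3) : transp := insubd tsigma (tperm i j).

Lemma val_tr i j : i != j -> val (tr i j) = tperm i j.
Proof. by move=> ij; rewrite val_insubd odd_tperm ij. Qed.

Fact odd_conj (t : transp) (g : 'S_3) : odd_perm (val t ^ g)%g.
Proof. by rewrite odd_permJ (valP t). Qed.

Definition tconj (g : 'S_3) (t : transp) : transp :=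
  exist _ (val t ^ g)%g (odd_conj t g).

Inductive gen := GenX of transp | GenY of transp | GenG of 'S_3 | GenD of 'S_3.

Definition gen_code (a : gen) : (transp + transp) + ('S_3 + 'S_3) :=
  match a with
  | GenX t => inl (inl t) | GenY t => inl (inr t)
  | GenG g => inr (inl g) | GenD g => inr (inr g)
  end.
Definition gen_decode (a : (transp + transp) + ('S_3 + 'S_3)) : gen :=
  match a with
  | inl (inl t) => GenX t | inl (inr t) => GenY t
  | inr (inl g) => GenG g | inr (inr g) => GenD g
  end.
Fact gen_codeK : cancel gen_code gen_decode. Proof. by case. Qed.
HB.instance Definition _ := Choice.copy gen (can_type gen_codeK).

(* Locked to keep unification away from the finite maps of malg. *)
HB.lock Definition free_gen (k : fieldType) (a : gen) : {malg k[{fmonom gen}]} :=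
  << 1 *g fmu a >>.

Section Double.
Variable k : fieldType.

Definition freeD := {malg k[{fmonom gen}]}.
HB.instance Definition _ := GRing.Lalgebra.on freeD.

Local Notation x t := (free_gen k (GenX t)).
Local Notation y t := (free_gen k (GenY t)).
Local Notation G g := (free_gen k (GenG g)).
Local Notation dl g := (free_gen k (GenD g)).
Local Notation sgn g := ((-1) ^+ (odd_perm g) : k).

Inductive relD : freeD -> freeD -> Prop :=
| relGM g h : relD (G g * G h) (G (comp3 g h))
| relG1 : relD (G 1%g) 1
| relDD g h : relD (dl g * dl h) (if g == h then dl g else 0)
| relDsum : relD (\sum_g dl g) 1
| relX2 t : relD (x t ^+ 2) 0
| relXX i j l : uniq [:: i; j; l] ->
    relD (x (tr i j) * x (tr i l) + x (tr j l) * x (tr i j)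
          + x (tr i l) * x (tr j l)) 0
| relY2 t : relD (y t ^+ 2) 0
| relYY i j l : uniq [:: i; j; l] ->
    relD (y (tr i j) * y (tr i l) + y (tr j l) * y (tr i j)
          + y (tr i l) * y (tr j l)) 0
| relDG h g : relD (dl h * G g) (G g * dl (h ^ g^-1)%g)
| relGX g t : relD (G g * x t) (sgn g *: (x (tconj g t) * G g))
| relDX h t : relD (dl h * x t) (x t * dl (comp3 (val t) h))
| relDY g t : relD (dl g * y t) (y t * dl (comp3 (val t) g))
| relYG t g : relD (y t * G g) (sgn g *: (G g * y (tconj g^-1%g t)))
| relYX t : relD (y t * x t + x t * y t)
    (1 + G (val t) * (dl (val t) - dl 1%g))
| relYX' i j l : uniq [:: i; j; l] ->
    relD (y (tr i l) * x (tr i j) + x (tr i j) * y (tr j l))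
      (G (val (tr i j)) *
         (dl (val (tr i l)) - dl (comp3 (val (tr i l)) (val (tr i j))))).

Definition alg := aquot relD.
HB.instance Definition _ := GRing.PzRing.on alg.
HB.instance Definition _ := GRing.Lmodule.on alg.

(* The counit, used to show that 1 is nonzero in alg. *)
Definition eps_gen (a : gen) : k :=
  match a with
  | GenX _ | GenY _ => 0 | GenG _ => 1 | GenD g => (g == 1%g)%:R
  end.
Definition eps_mon (m : {fmonom gen}) : k := \prod_(a <- m) eps_gen a.

Fact eps_mon_morph : mmorphism eps_mon.
Proof.
split=> [m1 m2|]; rewrite /eps_mon; last by rewrite fm1 big_nil.
by rewrite fmM big_cat.
Qed.
HB.instance Definition _ := isMultiplicative.Build {fmonom gen} k eps_mon
  eps_mon_morph.

Definition eps (u : freeD) : k := mmap idfun eps_mon u.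

Fact eps_genE a : eps (free_gen k a) = eps_gen a.
Proof. by rewrite /eps unlock mmapU /= mul1r /eps_mon fmuE big_seq1. Qed.

Fact epsD u v : eps (u + v) = eps u + eps v. Proof. exact: mmapD. Qed.
Fact epsB u v : eps (u - v) = eps u - eps v. Proof. exact: mmapB. Qed.
Fact epsM u v : eps (u * v) = eps u * eps v. Proof. exact: rmorphM. Qed.
Fact epsZ c u : eps (c *: u) = c * eps u. Proof. exact: mmapZ. Qed.
Fact eps0 : eps 0 = 0. Proof. exact: mmap0. Qed.
Fact eps1 : eps 1 = 1. Proof. exact: mmap1. Qed.

Fact morph_quad (A : nzRingType) (f : A -> k) :
  (forall u v, f (u + v) = f u + f v) -> (forall u v, f (u * v) = f u * f v) ->
  forall a b a' b' a'' b'', f a = 0 -> f a' = 0 -> f a'' = 0 ->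
  f (a * b + a' * b' + a'' * b'') = 0.
Proof. by move=> fD fM a b a' b' a'' b'' e e' e''; rewrite !fD !fM e e' e'' !mul0r !addr0. Qed.

Fact morph_cross (A : nzRingType) (f : A -> k) :
  (forall u v, f (u + v) = f u + f v) -> (forall u v, f (u - v) = f u - f v) ->
  (forall u v, f (u * v) = f u * f v) ->
  forall a b a' b' c d d', f a = 0 -> f a' = 0 -> f d = f d' ->
  f (a * b + a' * b') = f (c * (d - d')).
Proof.
move=> fD fB fM a b a' b' c d d' a0 a'0 dd'.
by rewrite fD !fM fB a0 a'0 dd' subrr mulr0 !mul0r addr0.
Qed.

Fact morph_diag (A : nzRingType) (f : A -> k) :
  (forall u v, f (u + v) = f u + f v) -> (forall u v, f (u - v) = f u - f v) ->
  (forall u v, f (u * v) = f u * f v) -> f 1 = 1 ->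
  forall a b c d d', f a = 0 -> f c = 1 -> f d = 0 -> f d' = 1 ->
  f (a * b + b * a) = f (1 + c * (d - d')).
Proof.
move=> fD fB fM f1 a b c d d' a0 c1 d0 d'1.
by rewrite !fD !fM fB f1 a0 c1 d0 d'1 sub0r mul1r subrr mulr0 mul0r addr0.
Qed.

Fact eps_rel u v : relD u v -> eps u = eps v.
Proof.
have gE := eps_genE; case.
- by move=> g h; rewrite epsM !gE mulr1.
- by rewrite gE eps1.
- move=> g h; rewrite epsM !gE /=; case: (eqVneq g h) => [->|gh].
    by rewrite /= gE /=; case: eqP; rewrite ?mulr1 ?mulr0.
  rewrite eps0; case: (eqVneq g 1%g) gh => [->|_ _]; last by rewrite mul0r.
  by rewrite eq_sym => /negPf ->; rewrite mulr0.
- have -> : eps (\sum_g free_gen k (GenD g)) = \sum_(g : 'S_3) (g == 1%g)%:R.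
    by rewrite (big_morph eps epsD eps0); apply: eq_bigr => g _; rewrite gE.
  by rewrite (bigD1 1%g) //= eqxx big1 ?addr0 ?eps1 // => g /negPf ->.
- by move=> t; rewrite expr2 epsM gE mul0r eps0.
- by move=> i j l _; rewrite eps0; apply: (morph_quad epsD epsM); exact: gE.
- by move=> t; rewrite expr2 epsM gE mul0r eps0.
- by move=> i j l _; rewrite eps0; apply: (morph_quad epsD epsM); exact: gE.
- move=> h g; apply: etrans (epsM _ _) (etrans _ (esym (epsM _ _))).
  rewrite !gE /= mulr1 mul1r.
  by rewrite -[in RHS](conj1g g^-1%g) (inj_eq (@conjg_inj _ _)).
- move=> g t; rewrite epsZ; apply: etrans (epsM _ _) (etrans _ (esym (congr1 _ (epsM _ _)))).
  by rewrite !gE /= mul0r !mulr0.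
- move=> g t; apply: etrans (epsM _ _) (etrans _ (esym (epsM _ _))).
  by rewrite !gE /= mul0r mulr0.
- move=> g t; apply: etrans (epsM _ _) (etrans _ (esym (epsM _ _))).
  by rewrite !gE /= mul0r mulr0.
- move=> t g; rewrite epsZ; apply: etrans (epsM _ _) (etrans _ (esym (congr1 _ (epsM _ _)))).
  by rewrite !gE /= mul0r !mulr0.
- move=> t; apply: (morph_diag epsD epsB epsM eps1); rewrite gE //= ?eqxx //.
  have /negPf -> // : val t != 1%g.
  by apply: contraTneq (valP t) => ->; rewrite odd_perm1.
move=> i j l; rewrite /= !inE negb_or => /and3P[/andP[ij il] jl _].
apply: (morph_cross epsD epsB epsM); rewrite !gE //= /comp3 !val_tr //.
have /negPf -> : tperm i l != 1%g.
  by apply/eqP => /(congr1 (@odd_perm _)); rewrite odd_tperm odd_perm1 il.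
have /negPf -> // : (tperm i j * tperm i l)%g != 1%g.
apply/eqP => /permP /(_ j); rewrite permM tpermR tpermL perm1 => /eqP.
by rewrite eq_sym (negPf jl).
Qed.

Lemma alg_neq0 : (1 : alg) != 0.
Proof.
apply/eqP => e; have h : genideal relD (1 - 0) := (apiP relD 1 0).1 (etrans e (esym (api0 _))).
move: h; rewrite subr0 => h.
have /(h [set u | eps u = 0]) : (two_sided [set u | eps u = 0] /\
   relset relD `<=` [set u | eps u = 0])%classic.
  split; first split => /=; first exact: eps0.
  - by move=> u v eu ev; rewrite epsD eu ev addr0.
  - move=> a u b eu; apply: etrans (epsM _ _) _.
    by rewrite (epsM a u) eu mulr0 mul0r.
  by move=> _ [a [b [ab ->]]] /=; rewrite epsB (eps_rel ab) subrr.
by rewrite /= eps1 => /eqP; rewrite oner_eq0.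
Qed.

HB.instance Definition _ := GRing.PzSemiRing_isNonZero.Build alg alg_neq0.
HB.instance Definition _ := GRing.Lmodule_isLalgebra.Build k alg
  (@aquot_scaleAl _ _ relD).
HB.instance Definition _ := GRing.Lalgebra_isAlgebra.Build k alg
  (@aquot_scaleAr _ _ (@malg_scaleAr k _) relD).

Definition X (t : transp) : alg := api relD (x t).
Definition Y (t : transp) : alg := api relD (y t).
Definition Gr (g : 'S_3) : alg := api relD (G g).
Definition Dl (g : 'S_3) : alg := api relD (dl g).

Definition subalg (S : set alg) : Prop :=
  [/\ S 1, forall c u v, S u -> S v -> S (c *: u + v)
    & forall u v, S u -> S v -> S (u * v)].

(* D(S_3), as the subalgebra of the double generated by the g and delta_g *)
Definition DS3 : set alg := smallest subalg (range Gr `|` range Dl).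

Definition scalars : set alg := range (fun c : k => c%:A).

(* B^n(V), as the span of the degree n monomials in the x_(ij) inside alg *)
Definition Bdeg (n : nat) : set alg :=
  genmod setT [set \prod_(t <- val s) X t | s in [set: n.-tuple transp]].

End Double.

Arguments DS3 k : clear implicits.
Arguments scalars k : clear implicits.
Arguments Bdeg k n : clear implicits.

Section DS3Modules.
Variable k : fieldType.

Definition ket (B : finType) (b : B) : {ffun B -> k^o} :=
  [ffun b' => (b' == b)%:R].

Definition lext (B : finType) (f : B -> {ffun B -> k^o}) (m : {ffun B -> k^o}) :
  {ffun B -> k^o} := \sum_b m b *: f b.

(* A finite-dimensional D(S_3)-module, with a homogeneous basis dsbasis:
   the basis vector b has degree [dsdeg b], and g acts by b |-> [dsact g b]. *)
Record dsmod := DSMod {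
  dsbasis : finType;
  dsdeg : dsbasis -> 'S_3;
  dsact : 'S_3 -> dsbasis -> {ffun dsbasis -> k^o};
  dsact1 : forall b, dsact 1%g b = ket b;
  dsactM : forall g h b, dsact (comp3 g h) b = lext (dsact g) (dsact h b);
  dsact_deg : forall g b b', dsact g b b' != 0 -> dsdeg b' = (dsdeg b ^ g)%g
}.

Definition dscar (M : dsmod) := {ffun dsbasis M -> k^o}.
HB.instance Definition _ M := GRing.Lmodule.on (dscar M).

Definition actG (M : dsmod) (g : 'S_3) (m : dscar M) : dscar M :=
  lext (@dsact M g) m.
Definition actD (M : dsmod) (h : 'S_3) (m : dscar M) : dscar M :=
  [ffun b => if dsdeg b == h then m b else 0].

Lemma lext_ket (B : finType) (f : B -> {ffun B -> k^o}) c b :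
  lext f (c *: ket b) = c *: f b.
Proof.
rewrite /lext (bigD1 b) //= big1 ?addr0 => [|b' /negPf bb'].
  by rewrite !ffunE eqxx /= [_ *: 1]mulr1.
by rewrite !ffunE bb' [_ *: 0]mulr0 scale0r.
Qed.

Definition sgn (g : 'S_3) : k := (-1) ^+ odd_perm g.

Definition sigma_act (g : 'S_3) (t : transp) := sgn g *: ket (tconj g t).

Fact sigma_act1 t : sigma_act 1%g t = ket t.
Proof.
rewrite /sigma_act /sgn odd_perm1 expr0 scale1r; congr ket.
by apply: val_inj; rewrite /= conjg1.
Qed.
Fact sigma_actM g h t :
  sigma_act (comp3 g h) t = lext (sigma_act g) (sigma_act h t).
Proof.
rewrite /sigma_act lext_ket scalerA /sgn /comp3 odd_permM signr_addb.
by congr (_ *: ket _); apply: val_inj; rewrite /= conjgM.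
Qed.
Fact sigma_act_deg g (t t' : transp) :
  sigma_act g t t' != 0 -> val t' = (val t ^ g)%g.
Proof.
by rewrite !ffunE; case: (eqVneq t' (tconj g t)) => [->|_] //; rewrite scaler0 eqxx.
Qed.

Definition Msigma : dsmod := DSMod sigma_act1 sigma_actM sigma_act_deg.

End DS3Modules.

(* Every g is sigma^s tau^t with s = odd_perm g and t = tau_exp g < 3. *)
Definition tau_exp (g : 'S_3) : 'I_3 := if odd_perm g then sigma (g p1) else g p1.

Definition sigmatau (u : bool * 'I_3) : 'S_3 :=
  comp3 (sigma ^+ u.1)%g (tau ^+ u.2)%g.

Lemma odd_tau : odd_perm tau = false.
Proof. by rewrite odd_permM !odd_tperm. Qed.

Lemma odd_sigmatau u : odd_perm (sigmatau u) = u.1.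
Proof.
case: u => s t; rewrite odd_permM [X in X (+) _](_ : _ = false) /=.
  by case: s => /=; rewrite ?expg0 ?odd_perm1 ?expg1 ?odd_tperm.
by elim: (t : nat) => [|n IH]; rewrite ?expg0 ?odd_perm1 // expgS odd_permM odd_tau.
Qed.
Lemma tau_exp_sigmatau u : tau_exp (sigmatau u) = u.2.
Proof.
rewrite /tau_exp odd_sigmatau /sigmatau /comp3; have [t1 t2 t3] := tauE.
case: u => -[] [[|[|[|//]]] /= lt]; rewrite ?expg0 ?expg1 ?expgS ?mul1g ?mulg1
  ?permM ?perm1 ?t1 ?t2 ?t3 ?expg0 ?perm1 ?permE; exact: val_inj.
Qed.
Lemma sigmatauE g : sigmatau (odd_perm g, tau_exp g) = g.
Proof.
have inj : injective sigmatau.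
  move=> [s t] [s' t'] e; congr pair.
    by move/(congr1 (@odd_perm _)): e; rewrite !odd_sigmatau.
  by move/(congr1 tau_exp): e; rewrite !tau_exp_sigmatau.
have bij : bijective sigmatau.
  apply: inj_card_bij inj _.
  by rewrite card_prod card_bool card_ord card_Sn.
have [f fK Kf] := bij.
by rewrite -(Kf g) odd_sigmatau tau_exp_sigmatau -surjective_pairing.
Qed.

Lemma tau_expM g h : tau_exp (comp3 g h) =
  tau_exp h + (if odd_perm h then - tau_exp g else tau_exp g).
Proof.
have a1 : tperm p1 p2 p1 = p2 by rewrite permE.
have a2 : tperm p1 p2 p2 = p1 by rewrite permE.
have a3 : tperm p1 p2 p3 = p3 by rewrite permE.
have b1 : tperm p2 p3 p1 = p1 by rewrite permE.
have b2 : tperm p2 p3 p2 = p3 by rewrite permE.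
have b3 : tperm p2 p3 p3 = p2 by rewrite permE.
rewrite -(sigmatauE g) -(sigmatauE h) !tau_exp_sigmatau odd_sigmatau.
rewrite [LHS]/tau_exp {1 2 3}/comp3 odd_permM !odd_sigmatau /= /sigmatau /comp3.
case: (odd_perm g) (tau_exp g) (odd_perm h) (tau_exp h) =>
  -[[|[|[|//]]] /= lt] -[] [[|[|[|//]]] /= lt'];
  rewrite ?expg0 ?expg1 ?expgS ?expg0 ?mulg1 ?mul1g ?permM ?perm1;
  rewrite ?(a1, a2, a3, b1, b2, b3); exact: val_inj.
Qed.

Lemma tau_conj g : (tau ^ g)%g = if odd_perm g then tau^-1%g else tau.
Proof.
have ts : (tau ^ sigma)%g = tau^-1%g.
  by rewrite /tau /sigma /comp3 conjgE invMg !tpermV -mulgA tperm2 mulg1.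
have tt n : (tau ^ (tau ^+ n))%g = tau by apply/conjg_fixP/commgP/commuteX.
rewrite -{1}(sigmatauE g) /sigmatau /comp3 /= conjgM tt.
by case: odd_perm; rewrite ?expg1 ?expg0 ?conjg1.
Qed.

Section Mtau.
Variables (k : fieldType) (zeta : k) (zeta_prim : 3.-primitive_root zeta).
Variable l : nat.

Let tchar (b : bool) : k := if b then zeta ^+ l else zeta ^- l.

Let tau_deg (b : bool) : 'S_3 := if b then tau else tau^-1%g.

(* true and false stand for |tau> and |tau^-1> *)
Definition tau_act (g : 'S_3) (b : bool) : {ffun bool -> k^o} :=
  tchar b ^+ tau_exp g *: ket k (odd_perm g (+) b).

Lemma tau_actE (s : bool) (t : 'I_3) (b : bool) :
  tau_act (comp3 (sigma ^+ s)%g (tau ^+ t)%g) b =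
    (if b then zeta ^+ (t * l) else zeta ^- (t * l)) *: ket k (s (+) b).
Proof.
rewrite /tau_act -[comp3 _ _]/(sigmatau (s, t)) odd_sigmatau tau_exp_sigmatau.
by case: b => /=; rewrite mulnC exprM ?exprVn.
Qed.

Fact tau_act1 b : tau_act 1%g b = ket k b.
Proof. by rewrite /tau_act /tau_exp odd_perm1 perm1 expr0 scale1r. Qed.

Fact tau_actM g h b : tau_act (comp3 g h) b = lext (tau_act g) (tau_act h b).
Proof.
have z3 : zeta ^+ 3 = 1 := prim_expr_order zeta_prim.
have c3 b' : tchar b' ^+ 3 = 1.
  by rewrite /tchar; case: b'; rewrite ?exprVn -exprM mulnC exprM z3 expr1n ?invr1.
rewrite /tau_act lext_ket scalerA tau_expM odd_permM addbA.
rewrite (addbC (odd_perm h)); congr (_ *: _).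
rewrite /= -[3%N]/3%N (expr_mod _ (c3 b)) exprD; congr (_ * _).
case: (odd_perm h) => //=; rewrite (expr_mod _ (c3 b)).
have -> : tchar (~~ b) = (tchar b)^-1 by rewrite /tchar; case: b => //=; rewrite invrK.
have c0 : tchar b \is a GRing.unit by apply/unitrPr; exists (tchar b ^+ 2); rewrite -exprS.
apply: (mulIr (unitrX (tau_exp g) c0)).
by rewrite -exprD subnK 1?ltnW // c3 exprVn mulVr // unitrX.
Qed.

Fact tau_act_deg g b b' : tau_act g b b' != 0 -> tau_deg b' = (tau_deg b ^ g)%g.
Proof.
rewrite !ffunE; case: (eqVneq b' (odd_perm g (+) b)) => [->|_]; last first.
  by rewrite scaler0 eqxx.
by move=> _; rewrite /tau_deg; case: b => /=; rewrite ?conjVg tau_conj;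
  case: odd_perm; rewrite /= ?invgK.
Qed.

Definition Mtau : dsmod k := DSMod tau_act1 tau_actM tau_act_deg.

End Mtau.

Section Modules.
Variables (k : fieldType) (W : lmodType (alg k)).
Implicit Types N S : set W.

Definition simple_submod N : Prop :=
  [/\ submod setT N, N <> [set 0]
    & forall N', submod setT N' -> N' `<=` N -> N' = [set 0] \/ N' = N].

Definition maximal_submod N : Prop :=
  [/\ submod setT N, N <> setT
    & forall N', submod setT N' -> N `<=` N' -> N' = N \/ N' = setT].

Definition socle : set W := genmod setT (\bigcup_(N in simple_submod) N).

Definition radical : set W := \bigcap_(N in maximal_submod) N.

(* M / rad M.  When M has a unique maximal submodule, as Verma modules do,
   radical is that submodule. *)
Definition headmod : lmodType (alg k) := lquot radical.

Definition dsum (I : finType) (N : I -> set W) S : Prop :=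
  S = [set \sum_i f i | f in [set f : I -> W | forall i, N i (f i)]] /\
  forall f : I -> W, (forall i, N i (f i)) -> \sum_i f i = 0 -> forall i, f i = 0.

(* Isomorphism of D(S_3)-modules; k acts on W through alg k. *)
Definition ds_iso N (M : dsmod k) : Prop :=
  exists f : dscar M -> W,
    [/\ forall c u v, f (c *: u + v) = c%:A *: f u + f v,
        forall g m, f (actG g m) = Gr k g *: f m,
        forall h m, f (actD h m) = Dl k h *: f m,
        injective f
      & range f = N].

Definition highest_weight (M : dsmod k) S : Prop :=
  exists N, [/\ submod (DS3 k) N, ds_iso N M,
    forall t u, N u -> Y k t *: u = 0 & genmod setT N = S].

Definition submod_iso S (L : lmodType (alg k)) : Prop :=
  exists f : {linear L -> W}, injective f /\ range f = S.

End Modules.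

Arguments socle {k} W.
Arguments radical {k} W.
Arguments headmod {k} W.

Section Verma.
Variables (k : fieldType) (M : dsmod k).

(* alg (x)_k M, with M = k^(dsbasis M) *)
Definition tensM := {ffun dsbasis M -> (alg k)^o}.
HB.instance Definition _ := GRing.Lmodule.on tensM.

Definition pure (d : alg k) (m : dscar M) : tensM := [ffun b => m b *: d].

(* The elements (d a) (x) m - d (x) (a m), for a running over the generators
   g, delta_g, y_(ij) of D^{>=0}; as a set of generators is enough to impose
   balancedness over D^{>=0}, the quotient is alg (x)_{D^{>=0}} M. *)
Definition balance : set tensM :=
  [set u | exists d m,
    [\/ exists g, u = pure (d * Gr k g) m - pure d (actG g m),
        exists h, u = pure (d * Dl k h) m - pure d (actD h m)
      | exists t, u = pure (d * Y k t) m - pure d 0]].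

Definition verma : lmodType (alg k) := lquot balance.

Definition tens (d : alg k) (m : dscar M) : verma := lpi balance (pure d m).

End Verma.

Section Socle.
Variable k : fieldType.

Definition t12 : transp := tr p1 p2.
Definition t23 : transp := tr p2 p3.
Definition t13 : transp := tr p1 p3.

Local Notation W := (verma (Msigma k)).
Local Notation x12 := (X k t12).
Local Notation x23 := (X k t23).
Local Notation x13 := (X k t13).
Local Notation "x |> t" := (@tens k (Msigma k) x (ket k t))
  (at level 45, no associativity).

Definition Msoc : set W :=
  genmod (scalars k) [set tens b m | b in Bdeg k 4 & m in setT].

Definition nvec (zeta : k) (l : nat) : W :=
  (zeta ^+ l *: (x13 * x12 * x23)) |> t23
  + (zeta ^- l *: (x12 * x13 * x23)) |> t12
  - (x12 * x13 * x12) |> t13.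

Definition rvec : W :=
  - ((x12 * x13 + x13 * x23) |> t12) - ((x12 * x23 + x13 * x12) |> t13).

Definition Nmod (zeta : k) (l : nat) : set W :=
  genmod (DS3 k) [set nvec zeta l].

Definition Rmod : set W := genmod (DS3 k) [set rvec].

End Socle.

Arguments Msoc k : clear implicits.
Arguments Rmod k : clear implicits.

(* Main.v *)
(** The Verma module has the k-basis [w|c>], where [w] runs over a basis of twelve
    words of B(V) and [c] over the transpositions.  In this basis the generators
    of the double act by explicit 36 x 36 matrices over Z; since these matrices
    satisfy the defining relations, they give a module on k^36, to which the Verma
    module maps by its universal property, and the 36 words are independent.
    B(V) is Frobenius with socle B^4(V), so every nonzero submodule meets
    B^4(V) (x) M(sigma,-) and hence contains [x_top|12>].  The submodule generated
    by that vector is the 10-dimensional span of M_soc, N_1, N_2 and R; it is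
    therefore the unique simple submodule.  As the y's kill R, which is isomorphic
    to M(sigma,-), the universal property gives an endomorphism of the Verma module
    with image the socle.  By nilpotency of the x's (Nakayama), proper submodules
    have no component of degree 0, so the kernel of this endomorphism is the unique
    maximal submodule, and the head is isomorphic to the socle. *)

From HB Require Import structures.
Require Import Defs.
From mathcomp Require Import all_boot all_order all_algebra all_fingroup.
From mathcomp Require Import generic_quotient ring_quotient.
From mathcomp Require Import boolp classical_sets.
From mathcomp.multinomials Require Import monalg.
From mathcomp Require Import zify ring.

Set Implicit Arguments.
Unset Strict Implicit.
Unset Printing Implicit Defensive.

Import GRing.Theory Quotient.
Local Open Scope classical_set_scope.
Local Open Scope quotient_scope.
Local Open Scope ring_scope.

(** * Computable model *)

(** The double is given as a quotient of a free algebra, so neither the dimension of the Verma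
    module nor the nonvanishing of a vector can be read off from the definition. This is why the
    tables [bact] serve twice: as matrices that satisfy the defining relations, which yields
    independence, and as the rule by which the generators act on words inside the Verma module,
    which follows from the relations alone. Once both are known, questions about submodules are
    finite, and existence is settled by certificates: explicit polynomials in the generators
    ([qtop], [qbas], [qword], [qrot]) whose effect on the basis vectors is computed. The
    computations take place in Z[zeta] and are carried to k by [phi]. In the tables zeta occurs only
    for the socle, through N_1 and N_2; separating these two costs a factor 3, which is inverted in
    k. *)

(* [(a, b)] stands for a + b zeta, with zeta^2 = -1 - zeta. *)
Definition zz := (int * int)%type.
Definition zadd (x y : zz) : zz := (x.1 + y.1, x.2 + y.2).
Definition zmul (x y : zz) : zz :=
  (x.1 * y.1 - x.2 * y.2, x.1 * y.2 + x.2 * y.1 - x.2 * y.2).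
Definition z0 : zz := (0, 0).
Definition z1 : zz := (1, 0).
Definition zN1 : zz := (-1, 0).
Definition zpow (n : nat) : zz := iter n (zmul (0, 1)) z1.

(* Sparse vectors of k^36.  The index 3 i + c is that of the basis vector [w|c>]
   with w the i-th of the [words] below.  Entries may repeat (they add up), and
   indices above 35 are ignored. *)
Definition svec := seq (zz * nat).

Definition scoef (l : svec) (j : nat) : zz :=
  foldr (fun x acc => if x.2 == j then zadd x.1 acc else acc) z0 l.
Definition snorm (l : svec) : svec :=
  [seq x <- [seq (scoef l j, j) | j <- iota 0 36] | x.1 != z0].
Definition sscale (c : zz) (l : svec) : svec :=
  [seq (zmul c x.1, x.2) | x <- l].
(** The inner [snorm] merges repeated entries and drops indices above 35, so that [f] only meets
    indices of basis vectors; the outer one keeps iterated applications short. *)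
Definition slin (f : nat -> svec) (l : svec) : svec :=
  snorm (flatten [seq sscale x.1 (f x.2) | x <- snorm l]).
Definition seqv (l l' : svec) : bool :=
  all (fun j => scoef l j == scoef l' j) (iota 0 36).
Arguments snorm : simpl never.
Arguments slin : simpl never.

(* [(s, a)] stands for sigma^s tau^a, with products composed right to left; the
   transposition sigma tau^a is also coded by a alone, so that 0, 1, 2 are (12),
   (23), (13). *)
Definition cperm := (bool * nat)%type.
(** Comes from tau^a sigma = sigma tau^(-a), the exponent -a being written 3 - a. *)
Definition cmul (g h : cperm) : cperm :=
  (g.1 (+) h.1, (h.2 + if h.1 then 3 - g.2 else g.2) %% 3)%N.
Definition cinv (g : cperm) : cperm := if g.1 then g else (false, (3 - g.2) %% 3)%N.
Definition cconj (g h : cperm) : cperm := cmul (cmul g h) (cinv g).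
(** The conjugation rack of the transpositions: a conjugate of sigma tau^a is odd again, so its
    exponent suffices. *)
Definition crack (g : cperm) (a : nat) : nat := (cconj g (true, a)).2.
Definition csgn (g : cperm) : zz := if g.1 then zN1 else z1.

Definition perms : seq cperm :=
  [seq (s, a) | s <- [:: false; true], a <- iota 0 3].

(* The words are suffix-closed, so that the recursion of [bYw] stays among them. *)
Definition words : seq (seq nat) :=
  [:: [::]; [:: 0]; [:: 1]; [:: 2]; [:: 0; 1]; [:: 0; 2]; [:: 1; 0]; [:: 1; 2];
      [:: 0; 1; 0]; [:: 0; 1; 2]; [:: 1; 0; 2]; [:: 0; 1; 0; 2]]%N.

(* Row a, column i: the normal form of x_a times the i-th word. *)
Definition xtab (a i : nat) : seq (zz * nat) :=
  nth [::] (nth [::] [::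
   [:: [:: (z1, 1)]; [::]; [:: (z1, 4)]; [:: (z1, 5)];
       [::]; [::]; [:: (z1, 8)]; [:: (z1, 9)];
       [::]; [::]; [:: (z1, 11)]; [::]];
   [:: [:: (z1, 2)]; [:: (z1, 6)]; [::]; [:: (z1, 7)];
       [:: (z1, 8)]; [:: (z1, 10)]; [::]; [::];
       [::]; [:: (z1, 11)]; [::]; [::]];
   [:: [:: (z1, 3)]; [:: (zN1, 4); (zN1, 7)]; [:: (zN1, 5); (zN1, 6)]; [::];
       [:: (z1, 10)]; [:: (zN1, 9)]; [:: (z1, 9)]; [:: (zN1, 10)];
       [:: (zN1, 11)]; [::]; [::]; [::]]] a) i.

Inductive cgen := CX of nat | CY of nat | CG of cperm | CD of cperm.

(* [bX], [bG], [bD], [bY]: images of the basis vector of index j. *)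
Definition bX (a j : nat) : svec :=
  [seq (x.1, 3 * x.2 + j %% 3)%N | x <- xtab a (j %/ 3)].

Fixpoint bGw (g : cperm) (w : seq nat) (c : nat) : svec :=
  if w is a :: w' then sscale (csgn g) (slin (bX (crack g a)) (bGw g w' c))
  else [:: (csgn g, crack g c)].
Definition bG (g : cperm) (j : nat) : svec :=
  bGw g (nth [::] words (j %/ 3)) (j %% 3).

Definition wdeg (w : seq nat) (c : nat) : cperm :=
  foldr (fun a => cmul (true, a)) (true, c) w.
Definition bD (h : cperm) (j : nat) : svec :=
  if wdeg (nth [::] words (j %/ 3)) (j %% 3) == h then [:: (z1, j)] else [::].

Definition widx (w : seq nat) (c : nat) : nat := (3 * index w words + c)%N.

(* y_t x_a = [t = a] + a (delta_t - delta_(t a)) - x_a y_(a t a) covers both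
   relations between the y's and the x's. *)
Fixpoint bYw (t : nat) (w : seq nat) (c : nat) : svec :=
  if w is a :: w' then
    let u := [:: (z1, widx w' c)] in
    sscale zN1 (slin (bX a) (bYw (crack (true, a) t) w' c))
    ++ (if t == a then u else [::])
    ++ slin (bG (true, a)) (slin (bD (true, t)) u ++
         sscale zN1 (slin (bD (cmul (true, t) (true, a))) u))
  else [::].
Definition bY (t j : nat) : svec :=
  bYw t (nth [::] words (j %/ 3)) (j %% 3).

Definition bact (a : cgen) : nat -> svec :=
  match a with
  | CX a => bX a | CY t => bY t | CG g => bG g | CD h => bD h
  end.

Definition spoly := seq (zz * seq cgen).
Definition pmono (w : seq cgen) (l : svec) : svec :=
  foldr (fun a => slin (bact a)) l w.
Definition papp (p : spoly) (l : svec) : svec :=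
  flatten [seq sscale x.1 (pmono x.2 l) | x <- p].
Definition peq (p q : spoly) : bool :=
  all (fun j => seqv (papp p [:: (z1, j)]) (papp q [:: (z1, j)])) (iota 0 36).

(** * The defining relations of the double, tested in the model *)

Definition transps : seq nat := iota 0 3.

(** There is one test for each constructor of [relD]. In the tests with a pair a != b, these stand
    for (ij) and (ik), and the third transposition (jk) is the conjugate of b by a. *)
Lemma check_GG : all (fun g => all (fun h =>
  peq [:: (z1, [:: CG g; CG h])] [:: (z1, [:: CG (cmul g h)])]) perms) perms.
Proof. by vm_compute. Qed.
Lemma check_G1 : peq [:: (z1, [:: CG (false, 0%N)])] [:: (z1, [::])].
Proof. by vm_compute. Qed.
Lemma check_DD : all (fun g => all (fun h =>
  peq [:: (z1, [:: CD g; CD h])]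
    (if g == h then [:: (z1, [:: CD g])] else [::])) perms) perms.
Proof. by vm_compute. Qed.
Lemma check_Dsum : peq [seq (z1, [:: CD g]) | g <- perms] [:: (z1, [::])].
Proof. by vm_compute. Qed.
Lemma check_X2 : all (fun t => peq [:: (z1, [:: CX t; CX t])] [::]) transps.
Proof. by vm_compute. Qed.
Lemma check_Y2 : all (fun t => peq [:: (z1, [:: CY t; CY t])] [::]) transps.
Proof. by vm_compute. Qed.
Lemma check_XX : all (fun a => all (fun b => (a != b) ==>
  peq [:: (z1, [:: CX a; CX b]); (z1, [:: CX (crack (true, a) b); CX a]);
          (z1, [:: CX b; CX (crack (true, a) b)])] [::]) transps) transps.
Proof. by vm_compute. Qed.
Lemma check_YY : all (fun a => all (fun b => (a != b) ==>
  peq [:: (z1, [:: CY a; CY b]); (z1, [:: CY (crack (true, a) b); CY a]);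
          (z1, [:: CY b; CY (crack (true, a) b)])] [::]) transps) transps.
Proof. by vm_compute. Qed.
Lemma check_DG : all (fun h => all (fun g =>
  peq [:: (z1, [:: CD h; CG g])] [:: (z1, [:: CG g; CD (cconj (cinv g) h)])])
  perms) perms.
Proof. by vm_compute. Qed.
Lemma check_GX : all (fun g => all (fun t =>
  peq [:: (z1, [:: CG g; CX t])] [:: (csgn g, [:: CX (crack g t); CG g])])
  transps) perms.
Proof. by vm_compute. Qed.
Lemma check_DX : all (fun h => all (fun t =>
  peq [:: (z1, [:: CD h; CX t])] [:: (z1, [:: CX t; CD (cmul (true, t) h)])])
  transps) perms.
Proof. by vm_compute. Qed.
Lemma check_DY : all (fun h => all (fun t =>
  peq [:: (z1, [:: CD h; CY t])] [:: (z1, [:: CY t; CD (cmul (true, t) h)])])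
  transps) perms.
Proof. by vm_compute. Qed.
Lemma check_YG : all (fun t => all (fun g =>
  peq [:: (z1, [:: CY t; CG g])] [:: (csgn g, [:: CG g; CY (crack (cinv g) t)])])
  perms) transps.
Proof. by vm_compute. Qed.
Lemma check_YX : all (fun t =>
  peq [:: (z1, [:: CY t; CX t]); (z1, [:: CX t; CY t])]
    [:: (z1, [::]); (z1, [:: CG (true, t); CD (true, t)]);
        (zN1, [:: CG (true, t); CD (false, 0%N)])]) transps.
Proof. by vm_compute. Qed.
Lemma check_YX' : all (fun a => all (fun b => (a != b) ==>
  peq [:: (z1, [:: CY b; CX a]); (z1, [:: CX a; CY (crack (true, a) b)])]
    [:: (z1, [:: CG (true, a); CD (true, b)]);
        (zN1, [:: CG (true, a); CD (cmul (true, b) (true, a))])])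
  transps) transps.
Proof. by vm_compute. Qed.

(** * From sparse vectors to matrices over k *)

Section Matrices.
Variables (k : fieldType) (zeta : k).
Hypothesis zeta_eq : zeta ^+ 2 = - 1 - zeta.

Definition phi (x : zz) : k := x.1%:~R + x.2%:~R * zeta.

Lemma phiD x y : phi (zadd x y) = phi x + phi y.
Proof. by rewrite /phi /= !intrD mulrDl addrACA. Qed.

Lemma phiM x y : phi (zmul x y) = phi x * phi y.
Proof.
rewrite /phi /= !(intrD, intrM, rmorphN) /=; ring: zeta_eq.
Qed.

Lemma phi_0 : phi z0 = 0. Proof. by rewrite /phi mul0r addr0. Qed.
Lemma phi_1 : phi z1 = 1. Proof. by rewrite /phi mul0r addr0. Qed.
Lemma phi_N1 : phi zN1 = -1. Proof. by rewrite /phi mul0r addr0 mulrN1z. Qed.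
Lemma phi_pow n : phi (zpow n) = zeta ^+ n.
Proof.
elim: n => [|n IH]; first exact: phi_1.
by rewrite /zpow iterS phiM -/(zpow n) IH exprS /phi mul1r add0r.
Qed.

Definition e_ (j : nat) : 'cV[k]_36 := \col_i (i == j :> nat)%:R.
Definition vec (l : svec) : 'cV[k]_36 := \sum_(x <- l) phi x.1 *: e_ x.2.

Lemma vec_coef l i : vec l i 0 = phi (scoef l i).
Proof.
rewrite /vec; elim: l => [|x l IH]; rewrite ?big_nil ?mxE ?phi_0 //.
rewrite big_cons !mxE IH /= eq_sym; case: eqP => _; last by rewrite mulr0 add0r.
by rewrite mulr1 phiD.
Qed.

Lemma seqvP l l' : seqv l l' -> vec l = vec l'.
Proof.
move=> /allP h; apply/colP => i; rewrite !vec_coef.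
by have /h/eqP -> : (i : nat) \in iota 0 36 by rewrite mem_iota ltn_ord.
Qed.

Lemma vec_cat l l' : vec (l ++ l') = vec l + vec l'.
Proof. exact: big_cat. Qed.
Lemma vec_scale c l : vec (sscale c l) = phi c *: vec l.
Proof.
rewrite /vec big_map scaler_sumr; apply: eq_bigr => x _.
by rewrite phiM scalerA.
Qed.
Lemma vec_flatten ls : vec (flatten ls) = \sum_(l <- ls) vec l.
Proof. by rewrite /vec big_flatten. Qed.
Lemma vec1 c j : vec [:: (c, j)] = phi c *: e_ j.
Proof. exact: big_seq1. Qed.
Lemma vece j : vec [:: (z1, j)] = e_ j.
Proof. by rewrite vec1 phi_1 scale1r. Qed.

Lemma col_sum (v : 'cV[k]_36) : v = \sum_(j < 36) v j 0 *: e_ j.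
Proof.
apply/colP => i; rewrite summxE (bigD1 i) //= !mxE eqxx mulr1 big1 ?addr0 // => j.
by rewrite eq_sym !mxE => /negPf; rewrite -val_eqE /= => ->; rewrite mulr0.
Qed.

Lemma vec_norm l : vec (snorm l) = vec l.
Proof.
have -> : vec l = \sum_(0 <= j < 36) phi (scoef l j) *: e_ j.
  by rewrite big_mkord [LHS]col_sum; apply: eq_bigr => j _; rewrite vec_coef.
rewrite /vec /snorm big_filter big_map big_mkcond; apply: eq_bigr => j _ /=.
by case: eqP => //= ->; rewrite phi_0 scale0r.
Qed.

Definition Mx (a : cgen) : 'M[k]_36 := \matrix_(i, j) vec (bact a j) i 0.

Lemma Mx_e a (j : 'I_36) : Mx a *m e_ j = vec (bact a j).
Proof.
apply/colP => i; rewrite mxE (bigD1 j) //= !mxE eqxx mulr1 big1 ?addr0 // => j'.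
by move=> /negPf; rewrite !mxE -val_eqE /= => ->; rewrite mulr0.
Qed.

Lemma Mx_vec a l : Mx a *m vec l = vec (slin (bact a) l).
Proof.
rewrite vec_norm vec_flatten big_map -[in LHS]vec_norm mulmx_sumr.
(* Membership in [snorm l] is what bounds the index by 36, as [Mx_e] requires. *)
rewrite [LHS]big_seq_cond [RHS]big_seq_cond; apply: eq_bigr => x.
rewrite andbT mem_filter => /andP[_ /mapP[j]]; rewrite mem_iota => jlt ->.
by rewrite -scalemxAr vec_scale -(Mx_e a (Ordinal (jlt : (j < 36)%N))).
Qed.

Definition Mw (w : seq cgen) : 'M[k]_36 := \prod_(a <- w) Mx a.
Definition Mp (p : spoly) : 'M[k]_36 := \sum_(x <- p) phi x.1 *: Mw x.2.

Lemma Mw_nil : Mw [::] = 1%:M. Proof. exact: big_nil. Qed.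
Lemma Mw_cons a w : Mw (a :: w) = Mx a *m Mw w. Proof. exact: big_cons. Qed.
Lemma Mw_vec w l : Mw w *m vec l = vec (pmono w l).
Proof.
elim: w => [|a w IH]; first by rewrite Mw_nil mul1mx.
by rewrite Mw_cons -mulmxA IH; apply: Mx_vec.
Qed.

Lemma Mp_vec p l : Mp p *m vec l = vec (papp p l).
Proof.
rewrite vec_flatten big_map mulmx_suml; apply: eq_bigr => x _.
by rewrite -scalemxAl Mw_vec vec_scale.
Qed.

Lemma mx_eq_e (A B : 'M[k]_36) : (forall j : 'I_36, A *m e_ j = B *m e_ j) -> A = B.
Proof.
move=> h; apply/matrixP => i j; have /(congr1 (fun M : 'cV_36 => M i 0)) := h j.
have aux (C : 'M[k]_36) : (C *m e_ j) i 0 = C i j.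
  rewrite mxE (bigD1 j) //= !mxE eqxx mulr1 big1 ?addr0 // => j'.
  by move=> /negPf; rewrite mxE -val_eqE /= => ->; rewrite mulr0.
by rewrite !aux.
Qed.

Lemma peqP p q : peq p q -> Mp p = Mp q.
Proof.
move=> /allP h; apply: mx_eq_e => j; rewrite -vece !Mp_vec; apply: seqvP.
by apply: h; rewrite mem_iota ltn_ord.
Qed.

Lemma Mp_nil : Mp [::] = 0. Proof. exact: big_nil. Qed.
Lemma Mp_cons c w p : Mp ((c, w) :: p) = phi c *: Mw w + Mp p.
Proof. exact: big_cons. Qed.
End Matrices.

(** * The 36-dimensional representation *)

Definition encP (g : 'S_3) : cperm := (odd_perm g, tau_exp g : nat).
Definition encT (t : transp) : nat := tau_exp (val t).

Lemma encP_perms g : encP g \in perms.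
Proof.
apply/allpairsP; exists (encP g); split; first by rewrite /=; case: odd_perm.
  by rewrite mem_iota ltn_ord.
by [].
Qed.
Lemma encT_transps t : encT t \in transps.
Proof. by rewrite /transps mem_iota ltn_ord. Qed.

Lemma encP_inj : injective encP.
Proof.
move=> g h [e1 e2]; rewrite -(sigmatauE g) -(sigmatauE h) e1.
by congr (sigmatau (_, _)); apply: val_inj.
Qed.
Lemma encT_inj : injective encT.
Proof.
move=> t u e; apply/val_inj/encP_inj.
by rewrite /encP (valP t) (valP u); congr pair.
Qed.

Lemma encP_val t : encP (val t) = (true, encT t).
Proof. by rewrite /encP (valP t). Qed.

Lemma encP_comp g h : encP (comp3 g h) = cmul (encP g) (encP h).
Proof.
rewrite /encP /cmul /= odd_permM addbC tau_expM; congr pair => /=.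
by case: (odd_perm h) => /=; rewrite ?modnDmr.
Qed.

Lemma encP1 : encP 1 = (false, 0%N).
Proof. by rewrite /encP /tau_exp odd_perm1 perm1. Qed.

Lemma encPV g : encP g^-1 = cinv (encP g).
Proof.
have e : cmul (encP g) (encP g^-1) = (false, 0%N).
  by rewrite -encP_comp -encP1 /comp3 mulVg.
have /allP/(_ _ (encP_perms g))/allP/(_ _ (encP_perms g^-1)) : all (fun x =>
  all (fun y => (cmul x y == (false, 0%N)) ==> (y == cinv x)) perms) perms by [].
by rewrite e eqxx => /eqP.
Qed.

Lemma encP_conj g h : encP (h ^ g)%g = cconj (encP g) (encP h).
Proof. by rewrite conj3E !encP_comp encPV. Qed.

Lemma encT_conj g t : encT (tconj g t) = crack (encP g) (encT t).
Proof. by rewrite /crack -encP_val -encP_conj. Qed.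

(** Relations range over triples of distinct points, tables over pairs of distinct transpositions;
    conjugating (il) by (ij) recovers (jl). *)
Lemma encT_tr i j l : uniq [:: i; j; l] ->
  encT (tr i j) != encT (tr i l) /\
  encT (tr j l) = crack (true, encT (tr i j)) (encT (tr i l)).
Proof.
rewrite /= !inE negb_or => /and3P[/andP[ij il] jl _]; split.
  rewrite (inj_eq encT_inj) -val_eqE /= !val_tr //; apply/eqP => /permP/(_ i).
  by rewrite !tpermL => /eqP; rewrite (negPf jl).
rewrite -encP_val -encT_conj; congr encT; apply: val_inj => /=.
by rewrite !val_tr // tpermJ tpermL tpermD // eq_sym.
Qed.

Lemma transp_sq (t : transp) : comp3 (val t) (val t) = 1%g.
Proof.
by apply: encP_inj; rewrite encP_comp encP1 encP_val /cmul /= subnKC // ltnW // ltn_ord.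
Qed.

Definition enc (a : gen) : cgen :=
  match a with
  | GenX t => CX (encT t) | GenY t => CY (encT t)
  | GenG g => CG (encP g) | GenD g => CD (encP g)
  end.

Section Rho.
Variables (k : fieldType) (zeta : k).
Hypothesis zeta_eq : zeta ^+ 2 = - 1 - zeta.
Local Notation Mx := (Mx zeta).

Definition rho_mon (m : {fmonom gen}) : 'M[k]_36 := \prod_(a <- m) Mx (enc a).

Fact rho_mon_morph : mmorphism rho_mon.
Proof.
split=> [m1 m2|]; rewrite /rho_mon; last by rewrite fm1 big_nil.
by rewrite fmM big_cat.
Qed.
HB.instance Definition _ := isMultiplicative.Build {fmonom gen} 'M[k]_36 rho_mon
  rho_mon_morph.

Definition rho (u : freeD k) : 'M[k]_36 := mmap (@scalar_mx k 36) rho_mon u.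

Fact rho_gen a : rho (free_gen k a) = Mx (enc a).
Proof. by rewrite /rho unlock mmapU /= mul1r /rho_mon fmuE big_seq1. Qed.
Fact rhoD u v : rho (u + v) = rho u + rho v. Proof. exact: mmapD. Qed.
Fact rhoB u v : rho (u - v) = rho u - rho v. Proof. exact: mmapB. Qed.
Fact rhoM u v : rho (u * v) = rho u *m rho v.
Proof.
have h : forall g m m', GRing.comm ((@scalar_mx k 36) (g : {malg k[{fmonom gen}]})@_m)
  (rho_mon m') by move=> g m m'; exact: esym (scalar_mxC _ _).
exact: (commr_mmap_is_multiplicative h).1.
Qed.
Fact rhoZ c u : rho (c *: u) = c *: rho u.
Proof. by rewrite -mul_scalar_mx; exact: mmapZ. Qed.
Fact rho0 : rho 0 = 0. Proof. exact: mmap0. Qed.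
Fact rho1 : rho 1 = 1%:M. Proof. exact: mmap1. Qed.
(* These forms spare failing attempts to rewrite with [rhoM] inside [freeD], which
   are slow. *)
Fact rho_mul_eq a b c d :
  rho a *m rho b = rho c *m rho d -> rho (a * b) = rho (c * d).
Proof. by move=> h; apply: etrans (rhoM _ _) (etrans h (esym (rhoM _ _))). Qed.
Fact rho_mulZ_eq a b z c d :
  rho a *m rho b = z *: (rho c *m rho d) -> rho (a * b) = rho (z *: (c * d)).
Proof.
move=> h; apply: etrans (rhoM _ _) (etrans h _).
by rewrite rhoZ; congr (_ *: _); apply: esym (rhoM _ _).
Qed.
Fact rho_mulB a c b d d' :
  rho a = rho c + (rho b *m rho d - rho b *m rho d') -> rho a = rho (c + b * (d - d')).
Proof.
move=> ->; rewrite rhoD -mulmxBr; congr (_ + _).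
by rewrite -rhoB; apply: esym (rhoM _ _).
Qed.
Fact rho_mul2 a b a' b' : rho (a * b + a' * b') = rho a *m rho b + rho a' *m rho b'.
Proof. by rewrite rhoD; congr (_ + _); apply: rhoM. Qed.
Fact rho_mul3 a b a' b' a'' b'' : rho (a * b + a' * b' + a'' * b'') =
  rho a *m rho b + rho a' *m rho b' + rho a'' *m rho b''.
Proof. by rewrite rhoD rho_mul2; congr (_ + _); apply: rhoM. Qed.

Lemma phi_csgn g : phi zeta (csgn (encP g)) = (-1) ^+ odd_perm g.
Proof. by rewrite /csgn /=; case: odd_perm; rewrite ?phi_N1 ?phi_1. Qed.

(** The codes of the permutations are pairwise distinct members of a list of length 6 = |S_3|, hence
    exhaust it. *)
Lemma sum_perms (V : nmodType) (F : cperm -> V) :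
  \sum_(g : 'S_3) F (encP g) = \sum_(x <- perms) F x.
Proof.
rewrite -(big_map encP xpredT F); apply: perm_big.
have u : uniq [seq encP g | g <- index_enum 'S_3].
  by rewrite (map_inj_uniq encP_inj) index_enum_uniq.
apply: uniq_perm => //; apply: (uniq_min_size u _ _).2.
  by move=> _ /mapP[g _ ->]; apply: encP_perms.
by rewrite size_map [index_enum _]unlock -enumT -cardE card_Sn.
Qed.

Let pE := (Mp_cons, Mp_nil, Mw_cons, Mw_nil, @phi_1 k zeta, @phi_N1 k zeta, @mulmx1,
  @scale1r, @scaleN1r, @addr0, phi_csgn).

Lemma rho_rel u v : relD u v -> rho u = rho v.
Proof.
have T := encT_transps; have P := encP_perms; case.
- move=> g h; rewrite rhoM !rho_gen /= encP_comp.
  have /allP/(_ _ (P g))/allP/(_ _ (P h))/(peqP zeta_eq) := check_GG.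
  by rewrite !pE.
- by rewrite rho_gen rho1 /= encP1; have /(peqP zeta_eq) := check_G1; rewrite !pE.
- move=> g h; rewrite rhoM !rho_gen /=.
  have /allP/(_ _ (P g))/allP/(_ _ (P h))/(peqP zeta_eq) := check_DD.
  rewrite (inj_eq encP_inj); case: eqP => _; rewrite !pE => ->; rewrite ?rho_gen //.
  by rewrite rho0.
- rewrite (big_morph rho rhoD rho0) rho1.
  have /(peqP zeta_eq) e := check_Dsum.
  transitivity (Mp zeta [seq (z1, [:: CD x]) | x <- perms]); last by rewrite e !pE.
  rewrite /Mp big_map; under eq_bigr do rewrite rho_gen.
  rewrite (sum_perms (fun x => Mx (CD x))); apply: eq_bigr => x _.
  by rewrite !pE.
- move=> t; rewrite expr2 rhoM rho0 !rho_gen /=.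
  by have /allP/(_ _ (T t))/(peqP zeta_eq) := check_X2; rewrite !pE.
- move=> i j l /encT_tr[ne e]; rewrite rho_mul3 rho0 !rho_gen /= e.
  have /allP/(_ _ (T (tr i j)))/allP/(_ _ (T (tr i l))) := check_XX.
  by rewrite ne => /(peqP zeta_eq); rewrite !pE !addrA.
- move=> t; rewrite expr2 rhoM rho0 !rho_gen /=.
  by have /allP/(_ _ (T t))/(peqP zeta_eq) := check_Y2; rewrite !pE.
- move=> i j l /encT_tr[ne e]; rewrite rho_mul3 rho0 !rho_gen /= e.
  have /allP/(_ _ (T (tr i j)))/allP/(_ _ (T (tr i l))) := check_YY.
  by rewrite ne => /(peqP zeta_eq); rewrite !pE !addrA.
- move=> h g; apply: rho_mul_eq; rewrite !rho_gen /= encP_conj encPV.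
  have /allP/(_ _ (P h))/allP/(_ _ (P g))/(peqP zeta_eq) := check_DG.
  by rewrite !pE.
- move=> g t; apply: rho_mulZ_eq; rewrite !rho_gen /= encT_conj.
  have /allP/(_ _ (P g))/allP/(_ _ (T t))/(peqP zeta_eq) := check_GX.
  by rewrite !pE.
- move=> h t; apply: rho_mul_eq; rewrite !rho_gen /= encP_comp encP_val.
  have /allP/(_ _ (P h))/allP/(_ _ (T t))/(peqP zeta_eq) := check_DX.
  by rewrite !pE.
- move=> h t; apply: rho_mul_eq; rewrite !rho_gen /= encP_comp encP_val.
  have /allP/(_ _ (P h))/allP/(_ _ (T t))/(peqP zeta_eq) := check_DY.
  by rewrite !pE.
- move=> t g; apply: rho_mulZ_eq; rewrite !rho_gen /= encT_conj encPV.
  have /allP/(_ _ (T t))/allP/(_ _ (P g))/(peqP zeta_eq) := check_YG.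
  by rewrite !pE.
- move=> t; apply: rho_mulB; rewrite rho_mul2 rho1 !rho_gen /= encP_val encP1.
  have /allP/(_ _ (T t))/(peqP zeta_eq) := check_YX.
  by rewrite !pE => ->.
move=> i j l /encT_tr[ne e]; rewrite -[X in _ = rho X]add0r; apply: rho_mulB.
rewrite rho_mul2 rho0 add0r !rho_gen /= e encP_comp !encP_val.
have /allP/(_ _ (T (tr i j)))/allP/(_ _ (T (tr i l))) := check_YX'.
by rewrite ne => /(peqP zeta_eq); rewrite !pE.
Qed.

(** Defined on a representative; independence of the choice holds because [rho] vanishes on the
    ideal of relations. *)
Definition rhoA (a : alg k) : 'M[k]_36 :=
  rho (repr (a : {quot genidealb (@relD k)})).

Lemma rho_ideal u : genideal (@relD k) u -> rho u = 0.
Proof.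
move=> /(_ [set v | rho v = 0]); apply; split; first split => /=.
- exact: rho0.
- by move=> v w v0 w0; rewrite rhoD v0 w0 addr0.
- move=> a v b v0; apply: etrans (rhoM _ _) _.
  by rewrite (rhoM a v) v0 mulmx0 mul0mx.
by move=> _ [a [b [/rho_rel ab ->]]] /=; rewrite rhoB ab subrr.
Qed.

Lemma rhoA_api u : rhoA (api (@relD k) u) = rho u.
Proof.
apply/eqP; rewrite -subr_eq0; apply/eqP; rewrite /rhoA -rhoB; apply: rho_ideal.
by apply/apiP; rewrite /api reprK.
Qed.

Lemma rhoAD a b : rhoA (a + b) = rhoA a + rhoA b.
Proof.
have [u ->] := api_surj a; have [v ->] := api_surj b.
by rewrite -apiD !rhoA_api rhoD.
Qed.
Lemma rhoAM a b : rhoA (a * b) = rhoA a *m rhoA b.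
Proof.
have [u ->] := api_surj a; have [v ->] := api_surj b.
by rewrite -apiM !rhoA_api rhoM.
Qed.
Lemma rhoAZ c a : rhoA (c *: a) = c *: rhoA a.
Proof. by have [u ->] := api_surj a; rewrite -apiZ !rhoA_api rhoZ. Qed.
Lemma rhoA1 : rhoA 1 = 1%:M.
Proof. by rewrite -(api1 (@relD k)) rhoA_api rho1. Qed.

End Rho.

(** * Universal property of the Verma module *)

Section LquotLift.
Variables (A : pzRingType) (U V : lmodType A) (G : set U) (f : {linear U -> V}).

Lemma lquot_lift : (forall u, G u -> f u = 0) ->
  exists g : {linear lquot G -> V}, forall u, g (lpi G u) = f u.
Proof.
move=> fG; pose g (q : lquot G) : V := f (repr (q : {quot genmodb G})).
have gE u : g (lpi G u) = f u.
  apply/eqP; rewrite -subr_eq0 -raddfB; apply/eqP.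
  have : genmod setT G (repr (lpi G u : {quot genmodb G}) - u).
    by apply/lpiP; rewrite {1}/lpi reprK.
  move=> /(_ [set v | f v = 0]); apply; split=> //; split=> [|v w|a v _] /=.
  - exact: linear0.
  - by rewrite linearD => -> ->; rewrite addr0.
  - by rewrite linearZ => /= ->; rewrite scaler0.
have glin : linear g.
  move=> a p q; have [u ->] := lpi_surj p; have [v ->] := lpi_surj q.
  by rewrite -lpiZ -lpiD !gE linearP.
pose gL : {linear lquot G -> V} :=
  HB.pack g (GRing.isLinear.Build A (lquot G) V *:%R g glin).
by exists gL.
Qed.
End LquotLift.

Definition Gen (k : fieldType) (a : gen) : alg k := api (@relD k) (free_gen k a).

(** Induction over the generators: every element is the image of a sum of scaled monomials, and a
    monomial is peeled off letter by letter. *)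
Lemma alg_gen (k : fieldType) (P : set (alg k)) :
  subalg P -> (forall a, P (Gen k a)) -> forall x, P x.
Proof.
move=> [P1 Plin PM] Pgen x; have [u ->] := api_surj x.
have P0 : P 0 by rewrite -(subrr 1) -(scaleN1r 1) addrC; apply: Plin.
have PZ c y : P y -> P (c *: y) by move=> Py; rewrite -[_ *: _]addr0; apply: Plin.
have Pmon c (s : seq gen) : P (api (@relD k) << c *g FMonom s >>).
  elim: s => [|a s IH].
    have -> : << c *g FMonom [::] >> = c *: 1 :> freeD k.
      rewrite -mul_malgC mulr1; congr << c *g _ >>.
      by apply: val_inj; rewrite /= fm1.
    by rewrite apiZ; apply: PZ.
  have -> : << c *g FMonom (a :: s) >> = free_gen k a * << c *g FMonom s >> :> freeD k.
    rewrite unlock malgM_def fgmulUU mul1r; congr << c *g _ >>.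
    by apply: val_inj; rewrite /= fmM fmuE.
  by rewrite apiM; apply: PM; [apply: Pgen | apply: IH].
rewrite (monalgE u) (big_morph _ (apiD (@relD k)) (api0 (@relD k))).
elim: (finmap.enum_fset _) => [|m ms IH]; first by rewrite big_nil.
by rewrite big_cons -[X in P (X + _)]scale1r; apply: Plin => //; case: m => s; apply: Pmon.
Qed.

Section KScaling.
Variables (k : fieldType) (W : lmodType (alg k)).
Implicit Types (c : k) (u v : W) (N : set W) (a : alg k).

(** The modules are over [alg k], and k acts through its image there; linearity over k is handled by
    this operation instead of a second module structure on the same type. *)
Definition kact c u : W := (c%:A : alg k) *: u.
Local Infix "**:" := kact (at level 40).

Lemma kactE c u : kact c u = c%:A *: u. Proof. by []. Qed.
Lemma kactAr a c u : a *: (c **: u) = c **: (a *: u).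
Proof.
have e : a * c%:A = c%:A * a by rewrite mulr_algl mulr_algr.
by rewrite /kact (scalerA a) e -scalerA.
Qed.
Lemma kactAl c a u : (c *: a) *: u = c **: (a *: u).
Proof. by rewrite -mulr_algl -scalerA. Qed.
Lemma kactDl u c d : (c + d) **: u = c **: u + d **: u.
Proof. by rewrite /kact (scalerDl 1) (scalerDl u). Qed.
Lemma kactA c d u : c **: (d **: u) = (c * d) **: u.
Proof.
have e : (c * d)%:A = c%:A * d%:A :> alg k by rewrite mulr_algl scalerA.
by rewrite /kact e -scalerA.
Qed.
Lemma kact1 u : 1 **: u = u.
Proof. by rewrite /kact (scale1r 1) scale1r. Qed.
Lemma kact0l u : 0 **: u = 0.
Proof. by rewrite /kact (scale0r 1) scale0r. Qed.
Lemma kactN1 u : -1 **: u = - u.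
Proof. by rewrite /kact (scaleN1r 1) scaleN1r. Qed.
Lemma kact0r c : c **: 0 = 0.
Proof. exact: scaler0. Qed.
Lemma kact_sumr c (I : Type) (r : seq I) (P : pred I) (F : I -> W) :
  c **: (\sum_(i <- r | P i) F i) = \sum_(i <- r | P i) c **: F i.
Proof. exact: scaler_sumr. Qed.
Lemma kact_suml u (I : Type) (r : seq I) (P : pred I) (F : I -> k) :
  (\sum_(i <- r | P i) F i) **: u = \sum_(i <- r | P i) F i **: u.
Proof. by rewrite (big_morph (kact^~ u) (kactDl u) (kact0l u)). Qed.

Definition ksub N : Prop :=
  [/\ N 0, forall u v, N u -> N v -> N (u + v) & forall c u, N u -> N (c **: u)].

Lemma stab_subalg N : ksub N -> subalg [set a | forall u, N u -> N (a *: u)].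
Proof.
move=> [N0 ND NZ]; split=> [u Nu|c a b Na Nb u Nu|a b Na Nb u Nu] /=.
- by rewrite scale1r.
- by rewrite scalerDl kactAl; apply: ND; [apply: NZ; apply: Na | apply: Nb].
- by rewrite -scalerA; apply: Na; apply: Nb.
Qed.

Lemma submod_gen N : ksub N -> (forall (x : gen) u, N u -> N (Gen k x *: u)) ->
  submod setT N.
Proof.
move=> kN Ngen; have [N0 ND NZ] := kN; split=> // a u _; apply: (alg_gen (stab_subalg kN)).
exact: Ngen.
Qed.

Lemma submod_DS3 N : ksub N -> (forall g u, N u -> N (Gr k g *: u)) ->
  (forall h u, N u -> N (Dl k h *: u)) -> submod (DS3 k) N.
Proof.
move=> kN NG NDl; have [N0 ND NZ] := kN; split=> // a u Da.
move=> Nu; apply: (Da [set x | forall u, N u -> N (x *: u)]) => //.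
split; first exact: stab_subalg.
by move=> _ [[g _ <-]|[h _ <-]]; [apply: NG|apply: NDl].
Qed.

Lemma DS3_scalar c : DS3 k c%:A.
Proof.
move=> S [[S1 Slin _] _].
by rewrite -[c%:A]addr0 -(addNr 1) -(scaleN1r 1); apply: (Slin _ _ _ S1 _); apply: Slin.
Qed.
Lemma DS3_ksub N : submod (DS3 k) N -> ksub N.
Proof. by move=> [N0 ND NZ]; split=> // c u; apply: (NZ _ _ (DS3_scalar c)). Qed.
Lemma submodT_ksub N : submod setT N -> ksub N.
Proof. by move=> [N0 ND NZ]; split=> // c u; apply: NZ. Qed.
Lemma scalars_ksub N : submod (scalars k) N <-> ksub N.
Proof.
split=> [[N0 ND NZ]|[N0 ND NZ]]; split=> //; first by move=> c u; apply: NZ; exists c.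
by move=> _ u [c _ <-]; apply: NZ.
Qed.
Lemma ksub_sum N (I : Type) (r : seq I) (P : pred I) (F : I -> W) :
  ksub N -> (forall i, P i -> N (F i)) -> N (\sum_(i <- r | P i) F i).
Proof. by move=> [N0 ND _] NF; elim/big_ind: _ => // u v; apply: ND. Qed.

Variable M : dsmod k.
Implicit Types m : dscar M.

Definition flin (s : dsbasis M -> W) m : W := \sum_b (m b : k) **: s b.

Lemma flin_linear s c m m' : flin s (c *: m + m') = c **: flin s m + flin s m'.
Proof.
rewrite /flin kact_sumr -big_split; apply: eq_bigr => b _.
by rewrite !ffunE kactDl kactA.
Qed.
Lemma flin_ket s b : flin s (ket k b) = s b.
Proof.
rewrite /flin (bigD1 b) //= ffunE eqxx kact1 big1 ?addr0 // => b' /negPf bb'.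
by rewrite ffunE bb' kact0l.
Qed.
Lemma flinZ s c m : flin s (c *: m) = c **: flin s m.
Proof. by rewrite /flin kact_sumr; apply: eq_bigr => b _; rewrite ffunE kactA. Qed.
Lemma flin0 s : flin s 0 = 0.
Proof. by rewrite -(scale0r 0) flinZ kact0l. Qed.
Lemma flin_sum s (I : finType) (F : I -> dscar M) :
  flin s (\sum_i F i) = \sum_i flin s (F i).
Proof.
rewrite /flin exchange_big; apply: eq_bigr => b _.
by rewrite sum_ffunE kact_suml.
Qed.

Lemma flinG s : (forall g b, Gr k g *: s b = flin s (dsact g b)) ->
  forall g m, flin s (actG g m) = Gr k g *: flin s m.
Proof.
move=> h g m; rewrite /actG /lext flin_sum /flin scaler_sumr; apply: eq_bigr => b _.
by rewrite kactAr h -flinZ.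
Qed.
Lemma flinD s : (forall h b, Dl k h *: s b = if dsdeg b == h then s b else 0) ->
  forall h m, flin s (actD h m) = Dl k h *: flin s m.
Proof.
move=> hd h m; rewrite /flin scaler_sumr; apply: eq_bigr => b _.
by rewrite kactAr hd ffunE; case: eqP; rewrite ?kact0l ?kact0r.
Qed.
End KScaling.

Infix "**:" := kact (at level 40).

Section VermaTheory.
Variables (k : fieldType) (M : dsmod k).
Implicit Types (d : alg k) (m : dscar M).

Lemma pureE d m b : pure d m b = (m b : k) *: d.
Proof. exact: ffunE. Qed.
Lemma tens_scaleE d (u : tensM M) b : (d *: u) b = d * u b.
Proof. exact: ffunE. Qed.
Lemma tens_addE (u v : tensM M) b : (u + v) b = u b + v b.
Proof. exact: ffunE. Qed.
Lemma tens_sumE (I : finType) (F : I -> tensM M) b : (\sum_i F i) b = \sum_i F i b.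
Proof. exact: sum_ffunE. Qed.

Lemma tensE d d' m : d *: tens d' m = tens (d * d') m.
Proof.
rewrite /tens -lpiZ; congr lpi; apply/ffunP => b; rewrite tens_scaleE.
apply: etrans (congr1 (GRing.mul d) (pureE d' m b)) _.
exact: etrans (esym (scalerAr _ _ _)) (esym (pureE _ _ _)).
Qed.
Lemma tens1 d m : tens d m = d *: tens 1 m.
Proof. by rewrite tensE mulr1. Qed.

Lemma lpi0 (A : pzRingType) (V : lmodType A) (G : set V) : lpi G 0 = 0.
Proof. by rewrite -(scale0r 0) lpiZ scale0r. Qed.

Lemma lpi_sum (A : pzRingType) (V : lmodType A) (G : set V) (I : finType) (F : I -> V) :
  lpi G (\sum_i F i) = \sum_i lpi G (F i).
Proof. by rewrite (big_morph (lpi G) (@lpiD _ _ G) (lpi0 G)). Qed.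

Lemma tens_ket d m : tens d m = d *: flin (fun b => tens 1 (ket k b)) m.
Proof.
rewrite tens1; congr (d *: _); rewrite /flin; under eq_bigr do rewrite kactE -lpiZ.
rewrite -lpi_sum; congr lpi; apply/ffunP => b; rewrite tens_sumE pureE.
rewrite (bigD1 b) //= big1 => [|b' /negPf bb']; rewrite tens_scaleE pureE ffunE.
  by rewrite eqxx scale1r mulr1 addr0.
by rewrite eq_sym bb' scale0r mulr0.
Qed.

Lemma verma_span (q : verma M) :
  exists u : dsbasis M -> alg k, q = \sum_b u b *: tens 1 (ket k b).
Proof.
have [u ->] := lpi_surj q; exists u; under eq_bigr do rewrite tensE mulr1.
rewrite -lpi_sum; congr lpi; apply/ffunP => b; rewrite tens_sumE.
rewrite (bigD1 b) //= big1 => [|b' /negPf bb']; rewrite pureE ffunE.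
  by rewrite eqxx scale1r addr0.
by rewrite eq_sym bb' scale0r.
Qed.

Lemma tensG d g m : tens (d * Gr k g) m = tens d (actG g m).
Proof. by apply/lpiP => N [_]; apply; exists d, m; apply: Or31; exists g. Qed.
Lemma tensD d h m : tens (d * Dl k h) m = tens d (actD h m).
Proof. by apply/lpiP => N [_]; apply; exists d, m; apply: Or32; exists h. Qed.

Lemma GenG_ket g b : Gr k g *: tens 1 (ket k b) =
  flin (fun b => tens 1 (ket k b)) (dsact g b) :> verma M.
Proof.
rewrite tensE mulr1 -[Gr k g]mul1r tensG tens_ket scale1r; congr flin.
by rewrite /actG -[ket k b]scale1r lext_ket scale1r.
Qed.

Lemma GenD_ket h b : Dl k h *: tens 1 (ket k b) =
  (if dsdeg b == h then tens 1 (ket k b) else 0) :> verma M.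
Proof.
rewrite tensE mulr1 -[Dl k h]mul1r tensD.
have -> : actD h (ket k b) = if dsdeg b == h then ket k b else 0.
  apply/ffunP => b'; rewrite !ffunE; case: (eqVneq b' b) => [->|bb'].
    by case: eqP => _; rewrite !ffunE ?eqxx.
  by case: eqP => _; case: eqP => _; rewrite ffunE // (negPf bb').
case: eqP => // _; by rewrite tens_ket flin0 scaler0.
Qed.

Lemma GenY_ket t b : Y k t *: tens 1 (ket k b) = 0 :> verma M.
Proof.
rewrite tensE mulr1 -[Y k t]mul1r.
have -> : tens (1 * Y k t) (ket k b) = tens 1 0.
  by apply/lpiP => N [_]; apply; exists 1, (ket k b); apply: Or33; exists t.
by rewrite tens_ket flin0 scaler0.
Qed.

Variables (V : lmodType (alg k)) (s : dsbasis M -> V).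

Definition tens_lift (u : tensM M) : V := \sum_b u b *: s b.

Lemma tens_lift_linear : linear tens_lift.
Proof.
move=> a u v; rewrite /tens_lift scaler_sumr -big_split; apply: eq_bigr => b _.
by rewrite tens_addE tens_scaleE scalerDl scalerA.
Qed.
HB.instance Definition _ := GRing.isLinear.Build (alg k) (tensM M) V *:%R tens_lift
  tens_lift_linear.

Lemma tens_lift_pure d m : tens_lift (pure d m) = d *: flin s m.
Proof.
rewrite /tens_lift /flin scaler_sumr; apply: eq_bigr => b _.
by rewrite pureE kactAl kactAr.
Qed.

(** Universal property of the induced module: the three hypotheses say that |b> -> s b is linear
    over D^{>=0}, with the y's acting by 0 on the source. They force the balancing relations to go
    to 0. *)
Lemma verma_lift :
    (forall g b, Gr k g *: s b = flin s (dsact g b)) ->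
    (forall h b, Dl k h *: s b = if dsdeg b == h then s b else 0) ->
    (forall t b, Y k t *: s b = 0) ->
  exists f : {linear verma M -> V}, forall d m, f (tens d m) = d *: flin s m.
Proof.
move=> sG sD sY.
have [|f fE] := @lquot_lift _ _ _ (@balance k M) tens_lift.
  have tl d m d' m' : d *: flin s m = d' *: flin s m' ->
      tens_lift (pure d m - pure d' m') = 0.
    move=> e; apply: etrans (raddfB _ _ _) _; apply/eqP; rewrite subr_eq0; apply/eqP.
    by apply: etrans (tens_lift_pure _ _) (etrans e (esym (tens_lift_pure _ _))).
  move=> _ [d [m [[g ->]|[h ->]|[t ->]]]]; apply: tl; rewrite -scalerA.
  - by rewrite flinG.
  - by rewrite flinD.
  rewrite flin0 scaler0.
  rewrite /flin scaler_sumr big1 ?scaler0 // => b _.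
  by rewrite kactAr sY kact0r.
by exists f => d m; apply: etrans (fE _) (tens_lift_pure _ _).
Qed.
End VermaTheory.

(** * The basis of the Verma module *)

Definition decT (a : nat) : transp := nth t12 [:: t12; t23; t13] a.

Lemma encT_decT a : (a < 3)%N -> encT (decT a) = a.
Proof.
case: a => [|[|[|//]]] _ /=; rewrite /encT /t12 /t23 /t13 val_tr // /tau_exp odd_tperm /=.
- by rewrite tpermL tpermR.
- by rewrite (tpermD (x := p2)) // tpermL.
- by rewrite tpermL tpermD.
Qed.
Lemma decT_encT t : decT (encT t) = t.
Proof. by apply: encT_inj; rewrite encT_decT // ltn_ord. Qed.

(** Distinct transpositions of three points move exactly one common point; calling it i brings the
    pair into the form in which the relations are stated. *)
Lemma transp_pair (a t : transp) : a != t ->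
  exists i j l, [/\ uniq [:: i; j; l], a = tr i j & t = tr i l].
Proof.
have trC i j : tr i j = tr j i by rewrite /tr tpermC.
rewrite -(decT_encT a) -(decT_encT t).
have := ltn_ord (tau_exp (val a)); have := ltn_ord (tau_exp (val t)).
rewrite -!/(encT _); case: (encT a) (encT t) => [|[|[|//]]] [|[|[|//]]] _ _;
  rewrite ?eqxx // => _.
- by exists p2, p1, p3.
- by exists p1, p2, p3.
- by exists p2, p3, p1.
- by exists p3, p2, p1.
- by exists p1, p3, p2.
- by exists p3, p1, p2.
Qed.

Section ApiExpand.
Variables (R : comNzRingType) (F : lalgType R) (rel : F -> F -> Prop).
Implicit Types a b c d : F.
Local Notation api := (api rel).

Lemma apiB a b : api (a - b) = api a - api b.
Proof. exact: (raddfB \pi_({quot genidealb rel})). Qed.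
Lemma api_mul2 a b c d : api (a * b + c * d) = api a * api b + api c * api d.
Proof. by rewrite apiD !apiM. Qed.
Lemma api_mul3 a b c d e f :
  api (a * b + c * d + e * f) = api a * api b + api c * api d + api e * api f.
Proof. by rewrite apiD api_mul2 apiM. Qed.
Lemma api_mulB a b d : api (a * (b - d)) = api a * (api b - api d).
Proof. by rewrite apiM apiB. Qed.
End ApiExpand.

(** For t = a one has t a = e and a t a = a, so the diagonal relation is the same formula with an
    additional 1; for t = (ik) and a = (ij) the conjugate a t a is (jk). *)
Lemma YX_comm (k : fieldType) (t a : transp) :
  Y k t * X k a = (t == a)%:R
    + Gr k (val a) * (Dl k (val t) - Dl k (comp3 (val t) (val a)))
    - X k a * Y k (tconj (val a) t).
Proof.
have YXa u v : relD u v -> api (@relD k) u = api (@relD k) v by exact: api_rel.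
apply/eqP; rewrite -subr_eq opprK; apply/eqP.
have [->|ta] := eqVneq t a.
  rewrite transp_sq.
  have -> : tconj (val a) a = a by apply: val_inj; rewrite /= conjgE mulKg.
  apply: etrans (etrans (esym (api_mul2 _ _ _ _ _)) (YXa _ _ (relYX k a))) _.
  by rewrite apiD api_mulB.
rewrite eq_sym in ta; have [i [j [l [u ea et]]]] := transp_pair ta.
have e := etrans (esym (api_mul2 _ _ _ _ _))
  (etrans (YXa _ _ (relYX' k u)) (api_mulB _ _ _ _)).
have [_] := encT_tr u; rewrite -ea -et -encP_val -encT_conj => /encT_inj ejl.
by move: e; rewrite -ea -et ejl add0r.
Qed.

(** * The model as a module over the double *)

Section Model.
Variables (k : fieldType) (zeta : k).
Hypothesis zeta_eq : zeta ^+ 2 = - 1 - zeta.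
Local Notation Mx := (Mx zeta).
Local Notation vec := (vec zeta).
Local Notation rhoA := (rhoA zeta).

(* The proof argument keeps the module structures for different zeta apart. *)
Definition Emod of zeta ^+ 2 = - 1 - zeta := 'cV[k]_36.
Local Notation E := (Emod zeta_eq).
HB.instance Definition _ := GRing.Zmodule.on E.

Definition E_scale (a : alg k) (v : E) : E := rhoA a *m v.

Fact E_scaleA a b v : E_scale a (E_scale b v) = E_scale (a * b) v.
Proof. by apply: etrans (mulmxA _ _ _) _; rewrite -(rhoAM zeta_eq). Qed.
Fact E_scale1 : left_id 1 E_scale.
Proof. by move=> v; apply: etrans (congr1 (mulmx^~ v) (rhoA1 zeta_eq)) (mul1mx _). Qed.
Fact E_scaleDr : right_distributive E_scale +%R.
Proof. by move=> a u v; apply: mulmxDr. Qed.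
Fact E_scaleDl v : {morph E_scale^~ v : a b / a + b}.
Proof.
by move=> a b; apply: etrans (congr1 (mulmx^~ v) (rhoAD zeta_eq a b)) (mulmxDl _ _ _).
Qed.
HB.instance Definition _ := GRing.Zmodule_isLmodule.Build (alg k) E
  E_scaleA E_scale1 E_scaleDr E_scaleDl.

Lemma kactEm (c : k) (v : E) : c **: v = c *: (v : 'cV[k]_36).
Proof.
by rewrite /kact -[LHS]/(rhoA c%:A *m v) (rhoAZ zeta_eq) (rhoA1 zeta_eq) -scalemxAl mul1mx.
Qed.

Lemma rhoA_gen a : rhoA (Gen k a) = Mx (enc a).
Proof. by rewrite (rhoA_api zeta_eq) rho_gen. Qed.

Lemma GenE a (v : E) : Gen k a *: v = Mx (enc a) *m v.
Proof. by rewrite -rhoA_gen. Qed.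

Definition sE (t : transp) : E := e_ k (encT t).

Lemma checkG_deg0 : all (fun g => all (fun a =>
  seqv (bG g a) [:: (csgn g, crack g a)]) transps) perms.
Proof. by vm_compute. Qed.
Lemma checkD_deg0 : all (fun h => all (fun a =>
  seqv (bD h a) (if (true, a) == h then [:: (z1, a)] else [::])) transps) perms.
Proof. by vm_compute. Qed.
Lemma checkY_deg0 : all (fun t => all (fun a => seqv (bY t a) [::]) transps) transps.
Proof. by vm_compute. Qed.

Lemma Mx_sE a t : Mx a *m e_ k (encT t) = vec (bact a (encT t)).
Proof.
have lt : (encT t < 36)%N by apply: leq_trans (ltn_ord _) _.
exact: (Mx_e zeta a (Ordinal lt)).
Qed.

Lemma sE_G g t : Gr k g *: sE t = flin (M := Msigma k) sE (@dsact _ (Msigma k) g t).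
Proof.
rewrite /dsact /= /sigma_act flinZ flin_ket kactEm GenE /= Mx_sE /sE encT_conj.
have /allP/(_ _ (encP_perms g))/allP/(_ _ (encT_transps t))/(seqvP zeta) -> := checkG_deg0.
by rewrite vec1 phi_csgn.
Qed.

Lemma sE_D h t : Dl k h *: sE t = if val t == h then sE t else 0.
Proof.
rewrite GenE /= Mx_sE.
have /allP/(_ _ (encP_perms h))/allP/(_ _ (encT_transps t))/(seqvP zeta) -> := checkD_deg0.
rewrite -encP_val (inj_eq encP_inj); case: eqP => _; first by rewrite vece.
exact: big_nil.
Qed.

Lemma sE_Y u t : Y k u *: sE t = 0.
Proof.
rewrite GenE /= Mx_sE.
have /allP/(_ _ (encT_transps u))/allP/(_ _ (encT_transps t))/(seqvP zeta) -> :=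
  checkY_deg0.
exact: big_nil.
Qed.

(** The degree 0 columns of the model behave like the |ij> of M(sigma,-) and are killed by the y's,
    so the universal property applies to them. *)
Lemma coord_exists : exists f : {linear verma (Msigma k) -> E},
  forall d t, f (@tens k (Msigma k) d (ket k t)) = d *: sE t.
Proof.
have [f fE] := @verma_lift k (Msigma k) E sE sE_G sE_D sE_Y.
by exists f => d t; apply: etrans (fE _ _) _; rewrite flin_ket.
Qed.

Local Notation W := (verma (Msigma k)).

Definition vket (c : nat) : W := @tens k (Msigma k) 1 (ket k (decT c)).
Definition xword (w : seq nat) (c : nat) : W :=
  foldr (fun a u => X k (decT a) *: u) (vket c) w.
Definition vbas (j : nat) : W := xword (nth [::] words (j %/ 3)) (j %% 3).
Definition velt (v : 'cV[k]_36) : W := \sum_(j < 36) v j 0 **: vbas j.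

Lemma velt_linear c u v : velt (c *: u + v) = c **: velt u + velt v.
Proof.
rewrite /velt kact_sumr -big_split; apply: eq_bigr => j _.
by rewrite !mxE kactDl kactA.
Qed.
Lemma velt0 : velt 0 = 0.
Proof. by rewrite /velt big1 // => j _; rewrite mxE kact0l. Qed.
Lemma veltZ c u : velt (c *: u) = c **: velt u.
Proof. by rewrite -[c *: u]addr0 velt_linear velt0 addr0. Qed.
Lemma veltD u v : velt (u + v) = velt u + velt v.
Proof. by rewrite -[u]scale1r velt_linear scale1r kact1. Qed.
Lemma veltN u : velt (- u) = - velt u.
Proof. by rewrite -(scaleN1r u) veltZ kactN1. Qed.
Lemma velt_sum (I : Type) (r : seq I) (P : pred I) (F : I -> 'cV[k]_36) :
  velt (\sum_(i <- r | P i) F i) = \sum_(i <- r | P i) velt (F i).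
Proof. exact: (big_morph velt veltD velt0). Qed.

Lemma velt_e (j : nat) : (j < 36)%N -> velt (e_ k j) = vbas j.
Proof.
move=> jlt; rewrite /velt (bigD1 (Ordinal jlt)) //= mxE eqxx kact1.
rewrite big1 ?addr0 // => i; rewrite -val_eqE /= => /negPf ij.
by rewrite mxE ij kact0l.
Qed.

Lemma vbas_xword i c : (c < 3)%N -> vbas (3 * i + c) = xword (nth [::] words i) c.
Proof.
by move=> c3; rewrite /vbas mulnC divnMDl // modnMDl (divn_small c3) addn0 modn_small.
Qed.

Lemma X_X_act (a b : nat) : a != b -> (a < 3)%N -> (b < 3)%N ->
  forall u : W, X k (decT a) *: (X k (decT b) *: u) =
  - (X k (decT (crack (true, a) b)) *: (X k (decT a) *: u))
  - (X k (decT b) *: (X k (decT (crack (true, a) b)) *: u)).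
Proof.
move=> ab a3 b3 u.
have ne : decT a != decT b.
  by apply: contra ab => /eqP/(congr1 encT); rewrite !encT_decT // => ->.
have [i [j [l [uq ea eb]]]] := transp_pair ne.
have [_ ec] := encT_tr uq.
have := etrans (esym (api_mul3 _ _ _ _ _ _ _)) (etrans (api_rel (relXX k uq)) (api0 _)).
rewrite -ea -eb.
have -> : tr j l = decT (crack (true, a) b).
  by rewrite -(decT_encT (tr j l)) ec -ea -eb !encT_decT.
move=> e; have aux (p q r : W) : p + q + r = 0 -> p = - q - r.
  by move/eqP; rewrite -addrA addr_eq0 opprD => /eqP.
apply: aux; rewrite (scalerA (X k (decT a))) (scalerA (X k (decT b))).
rewrite (scalerA (X k (decT (crack (true, a) b)))) -!scalerDl.
by apply: etrans (congr1 (fun x => x *: u) e) (scale0r _).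
Qed.
End Model.

(** * Normal forms of words in the x's *)

Section WordReduction.
Variables (V : zmodType) (x : nat -> V -> V).
Hypothesis xB : forall a u v, x a (u - v) = x a u - x a v.
Hypothesis xx : forall a u, (a < 3)%N -> x a (x a u) = 0.
Hypothesis xxx : forall a b u, a != b -> (a < 3)%N -> (b < 3)%N ->
  x a (x b u) = - x (crack (true, a) b) (x a u) - x b (x (crack (true, a) b) u).

(** The rewriting rules are: squares vanish, x_2 x_0 and x_2 x_1 are eliminated by the quadratic
    relations, and x_1 x_0 x_1 becomes x_0 x_1 x_0. Abstract operators on an abelian group keep this
    rewriting away from the Verma module. *)
Lemma word_reduction a i u : (a < 3)%N -> (i < 12)%N ->
  x a (foldr x u (nth [::] words i)) =
    \sum_(y <- xtab a i) foldr x u (nth [::] words y.2) *~ y.1.1.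
Proof.
have x0 b : x b 0 = 0 by have := xB b 0 0; rewrite !subrr.
have xN b v : x b (- v) = - x b v by rewrite -sub0r xB x0 sub0r.
have x20 v : x 2 (x 0 v) = - x 0 (x 1 v) - x 1 (x 2 v).
  by rewrite (xxx _ (a := 2%N) (b := 0%N)) //= addrC.
have x21 v : x 2 (x 1 v) = - x 0 (x 2 v) - x 1 (x 0 v).
  exact: (xxx _ (a := 2%N) (b := 1%N)).
have x01 v : x 0 (x 1 v) = - x 2 (x 0 v) - x 1 (x 2 v).
  exact: (xxx _ (a := 0%N) (b := 1%N)).
(* The braid relation: by [x01], both sides equal - x_1 x_2 x_0 v. *)
have x101 v : x 1 (x 0 (x 1 v)) = x 0 (x 1 (x 0 v)).
  by rewrite x01 (x01 (x 0 v)) !xx // x0 oppr0 add0r xB xN (xx (a := 1%N)) // subr0.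
have x00 := @xx 0%N _ isT; have x11 := @xx 1%N _ isT; have x22 := @xx 2%N _ isT.
have N1 (v : V) : v *~ (-1) = - v by rewrite mulrN1z.
case: a i => [|[|[|//]]] [|[|[|[|[|[|[|[|[|[|[|[|//]]]]]]]]]]]] _ _;
  rewrite ?(big_cons, big_nil) /= ?N1 ?mulr1z ?addr0;
  rewrite ?(x00, x11, x22, x20, x21, x101, x0, xN, xB, oppr0, addr0,
    add0r, opprK, subr0, sub0r) //.
Qed.
End WordReduction.

(* Otherwise failing unifications unfold the computations. *)
Opaque Mx slin snorm bact.

Lemma scaler_expand (A : pzRingType) (V : lmodType A) (p q r s x y : A) (u : V) :
  (p + q * (r - s) - x * y) *: u = p *: u + q *: (r *: u - s *: u) - x *: (y *: u).
Proof. by rewrite !scalerA -scalerBl scalerBl scalerDl !scalerA. Qed.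

Section VermaBasis.
Variables (k : fieldType) (zeta : k).
Hypothesis zeta_eq : zeta ^+ 2 = - 1 - zeta.
Local Notation Mx := (Mx zeta).
Local Notation vec := (vec zeta).
Local Notation W := (verma (Msigma k)).
Local Notation velt := (@velt k).
Local Notation xword := (@xword k).
Local Notation vbas := (@vbas k).

Lemma X_sq t (u : W) : X k t *: (X k t *: u) = 0.
Proof.
have e : X k t * X k t = 0.
  by apply: etrans (esym (apiM _ _ _)) (etrans (api_rel (relX2 k t)) (api0 _)).
by rewrite (scalerA (X k t)) e scale0r.
Qed.

Lemma velt_vec l : velt (vec l) = \sum_(x <- l) phi zeta x.1 **: velt (e_ k x.2).
Proof. by rewrite /vec velt_sum; apply: eq_bigr => x _; rewrite veltZ. Qed.

(** As the zeta-parts of the entries vanish, the integer multiples in [word_reduction] agree with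
    the scalars given by [phi]. *)
Lemma xtab_range : all (fun a => all (fun i =>
  all (fun y => (y.2 < 12)%N && (y.1.2 == 0)) (xtab a i)) (iota 0 12)) transps.
Proof. by []. Qed.

Lemma divn36 (j : nat) : (j < 36)%N -> (j %/ 3 < 12)%N.
Proof. by rewrite ltn_divLR. Qed.

Lemma X_e t (j : 'I_36) : X k t *: velt (e_ k j) = velt (vec (bX (encT t) j)).
Proof.
have i12 := divn36 (ltn_ord j); rewrite velt_e // /vbas -{1}(decT_encT t).
set c := (j %% 3)%N; have c3 : (c < 3)%N by rewrite ltn_mod.
pose x a (u : W) := X k (decT a) *: u.
rewrite /xword -[LHS]/(x (encT t) (foldr x (vket k c) (nth [::] words (j %/ 3)))).
rewrite word_reduction //; first last.
- exact: ltn_ord.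
- by move=> a b u ab a3 b3; apply: X_X_act.
- by move=> a u _; apply: X_sq.
- by move=> a u v; apply: scalerBr.
rewrite velt_vec big_map big_seq [RHS]big_seq; apply: eq_bigr => y yin.
have /allP/(_ _ (encT_transps t))/allP/(_ (j %/ 3)%N) := xtab_range.
rewrite mem_iota i12 => /(_ isT)/allP/(_ _ yin)/andP[y12 /eqP y0].
have lt : (3 * y.2 + c < 36)%N.
  by move: y12 c3; clearbody c; clear; case: y => y1 y2 /=; lia.
rewrite /= velt_e //.
rewrite vbas_xword // /phi y0 mul0r addr0 -/(xword _ _).
have aux (n : int) (v : W) : v *~ n = n%:~R **: v.
  rewrite /kact -[n%:~R *: 1]/((n%:~R : k)%:A : alg k).
  by rewrite scaler_int -scaler_int.
exact: aux.
Qed.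

Lemma velt_ext a (A : 'M[k]_36) :
  (forall j : 'I_36, a *: velt (e_ k j) = velt (A *m e_ k j)) ->
  forall v, a *: velt v = velt (A *m v).
Proof.
move=> h v; rewrite [v]col_sum mulmx_sumr !velt_sum scaler_sumr; apply: eq_bigr => j _.
by rewrite veltZ kactAr h -scalemxAr veltZ.
Qed.

Lemma X_velt t v : X k t *: velt v = velt (Mx (CX (encT t)) *m v).
Proof. by move: v; apply: velt_ext => j; rewrite X_e Mx_e. Qed.

Lemma GX_act g t (u : W) :
  Gr k g *: (X k t *: u) = (-1) ^+ odd_perm g **: (X k (tconj g t) *: (Gr k g *: u)).
Proof.
have e : Gr k g * X k t = (-1) ^+ odd_perm g *: (X k (tconj g t) * Gr k g).
  apply: etrans (esym (apiM _ _ _)) (etrans (api_rel (relGX k g t)) _).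
  exact: etrans (apiZ _ _ _) (congr1 _ (apiM _ _ _)).
by rewrite (scalerA (Gr k g)) e kactAl -scalerA.
Qed.

Lemma DX_act h t (u : W) : Dl k h *: (X k t *: u) = X k t *: (Dl k (comp3 (val t) h) *: u).
Proof.
have e : Dl k h * X k t = X k t * Dl k (comp3 (val t) h).
  by apply: etrans (esym (apiM _ _ _)) (etrans (api_rel (relDX k h t)) (apiM _ _ _)).
by rewrite (scalerA (Dl k h)) e -scalerA.
Qed.

Lemma YX_act t a (u : W) : Y k t *: (X k a *: u) = (t == a)%:R *: u
  + Gr k (val a) *: (Dl k (val t) *: u - Dl k (comp3 (val t) (val a)) *: u)
  - X k a *: (Y k (tconj (val a) t) *: u).
Proof.
by rewrite (scalerA (Y k t)) YX_comm; apply: scaler_expand.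
Qed.

Lemma velt_vket c : (c < 3)%N -> velt (e_ k c) = vket k c.
Proof.
move=> c3; rewrite velt_e; last exact: leq_trans c3 _.
exact: (vbas_xword k 0 c3).
Qed.

Lemma G_xword g w c : all (fun a => a < 3)%N w -> (c < 3)%N ->
  Gr k g *: xword w c = velt (vec (bGw (encP g) w c)).
Proof.
move=> w3 c3; elim: w w3 => [_|a w IH /= /andP[a3 w3]].
  rewrite /= /vket; have := @GenG_ket _ (Msigma k) g (decT c) => /= ->.
  rewrite /sigma_act flinZ flin_ket vec1 phi_csgn veltZ; congr (_ **: _).
  rewrite -[in crack _ _](encT_decT c3) -encT_conj velt_vket; last exact: ltn_ord.
  by rewrite /vket decT_encT.
rewrite GX_act IH // X_velt Mx_vec // [in RHS]/= vec_scale // veltZ phi_csgn.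
by rewrite encT_conj encT_decT.
Qed.

Definition wprod (w : seq nat) (c : nat) : 'S_3 :=
  foldr (fun a h => comp3 (val (decT a)) h) (val (decT c)) w.

Lemma encP_wprod w c : all (fun a => a < 3)%N w -> (c < 3)%N ->
  encP (wprod w c) = wdeg w c.
Proof.
move=> w3 c3; elim: w w3 => [_|a w IH /= /andP[a3 w3]]; first by rewrite encP_val encT_decT.
by rewrite encP_comp encP_val encT_decT // IH.
Qed.

Lemma D_wprod h w c : Dl k h *: xword w c = if wprod w c == h then xword w c else 0.
Proof.
elim: w h => [|a w IH] h /=.
  rewrite /vket; have := @GenD_ket _ (Msigma k) h (decT c) => /= ->.
  by [].
rewrite DX_act IH; set t := val (decT a).
have -> : (comp3 t (wprod w c) == h) = (wprod w c == comp3 t h).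
  have cA x y z : comp3 (comp3 x y) z = comp3 x (comp3 y z) by rewrite /comp3 mulgA.
  have tt := transp_sq (decT a).
  by apply/eqP/eqP => [<-|->]; rewrite -cA tt /comp3 mulg1.
by case: eqP => // _; rewrite scaler0.
Qed.

Lemma words_lt3 i : all (fun a => a < 3)%N (nth [::] words i).
Proof.
have [|h] := ltnP i 12; last by rewrite nth_default.
by do 12! [case: i => [//|i]].
Qed.

Lemma G_e g (j : 'I_36) : Gr k g *: velt (e_ k j) = velt (vec (bG (encP g) j)).
Proof. by rewrite velt_e // /vbas G_xword ?words_lt3 ?ltn_mod. Qed.

Lemma D_e h (j : 'I_36) : Dl k h *: velt (e_ k j) = velt (vec (bD (encP h) j)).
Proof.
rewrite velt_e // /vbas D_wprod /bD -encP_wprod ?words_lt3 ?ltn_mod // (inj_eq encP_inj).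
case: eqP => _; first by rewrite vece velt_e.
by rewrite [vec _]big_nil velt0.
Qed.

Lemma G_velt g v : Gr k g *: velt v = velt (Mx (CG (encP g)) *m v).
Proof. by move: v; apply: velt_ext => j; rewrite G_e Mx_e. Qed.
Lemma D_velt h v : Dl k h *: velt v = velt (Mx (CD (encP h)) *m v).
Proof. by move: v; apply: velt_ext => j; rewrite D_e Mx_e. Qed.

Fixpoint wsuffixes (w : seq nat) : bool :=
  if w is _ :: w' then (w' \in words) && wsuffixes w' else true.
Lemma words_suffixes i : wsuffixes (nth [::] words i).
Proof.
have [|h] := ltnP i 12; last by rewrite nth_default.
by do 12! [case: i => [//|i]].
Qed.

Lemma widx_lt w c : w \in words -> (c < 3)%N -> (widx w c < 36)%N.
Proof.
by rewrite -index_mem /widx -[size words]/12%N; move: (index w words) => n; clear; lia.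
Qed.
Lemma velt_widx w c : w \in words -> (c < 3)%N -> velt (e_ k (widx w c)) = xword w c.
Proof. by move=> win c3; rewrite velt_e ?widx_lt // /widx vbas_xword // nth_index. Qed.

Lemma bYw_cons t a w c (e := e_ k (widx w c)) : vec (bYw t (a :: w) c) =
  - (Mx (CX a) *m vec (bYw (crack (true, a) t) w c)) + ((t == a)%:R *: e
  + Mx (CG (true, a)) *m
      (Mx (CD (true, t)) *m e - Mx (CD (cmul (true, t) (true, a))) *m e)).
Proof.
have -> : e = vec [:: (z1, widx w c)] by rewrite vece.
have N (v : 'cV[k]_36) : - v = phi zeta zN1 *: v by rewrite phi_N1 scaleN1r.
have -> (v : 'cV[k]_36) : (t == a)%:R *: v = if t == a then v else 0.
  by case: eqP; rewrite ?scale1r ?scale0r.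
rewrite (Mx_vec zeta_eq (CX a)) 2!(Mx_vec zeta_eq (CD _)) N (N (vec _)).
rewrite -(vec_scale zeta_eq zN1 (slin (bact (CD _)) _)) -vec_cat (Mx_vec zeta_eq).
rewrite -(vec_scale zeta_eq).
rewrite [LHS](@vec_cat k zeta _ (_ ++ _)) (@vec_cat k zeta _ (slin _ _)).
by congr (_ + (_ + _)); case: eqP => // _; apply: big_nil.
Qed.

(** Induction on the word: y is moved past the first letter by the commutation formula. The
    remaining suffix must be a listed word, so that [widx] in [bYw] is its index. *)
Lemma Y_xword t w c : wsuffixes w -> all (fun a => a < 3)%N w -> (c < 3)%N ->
  Y k t *: xword w c = velt (vec (bYw (encT t) w c)).
Proof.
move=> + + c3; elim: w t => [|a w IH] t.
  by rewrite /= [vec _]big_nil velt0 => _ _; apply: GenY_ket.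
move=> /andP[win ws] /andP[a3 w3].
rewrite bYw_cons !veltD veltN.
apply: etrans (YX_act t (decT a) (xword w c)) _.
rewrite addrC; congr (_ + (_ + _)); last first.
- rewrite -(velt_widx win c3) !D_velt -veltN -veltD G_velt encP_comp !encP_val.
  by rewrite encT_decT.
- rewrite veltZ (velt_widx win c3) -(inj_eq encT_inj) (encT_decT a3).
  by case: eqP => _; rewrite ?scale1r ?kact1 ?scale0r ?kact0l.
by rewrite (IH _ ws w3) encT_conj encP_val (encT_decT a3) X_velt (encT_decT a3).
Qed.

Lemma Y_velt t v : Y k t *: velt v = velt (Mx (CY (encT t)) *m v).
Proof.
move: v; apply: velt_ext => j; rewrite Mx_e velt_e // /vbas.
by rewrite Y_xword ?words_suffixes ?words_lt3 ?ltn_mod.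
Qed.

(** The intertwining property that turns questions about submodules of the Verma module into
    computations with columns. *)
Lemma Gen_velt a v : Gen k a *: velt v = velt (Mx (enc a) *m v).
Proof. by case: a => x; [apply: X_velt|apply: Y_velt|apply: G_velt|apply: D_velt]. Qed.
End VermaBasis.

(** * Coordinates on the Verma module *)

Definition permC (g : cperm) : 'S_3 := sigmatau (g.1, inord g.2).

Lemma encP_permC g : g \in perms -> encP (permC g) = g.
Proof.
case/allpairsP => -[s a] [_ a3 ->] /=; move: a3; rewrite mem_iota /= => a3.
by rewrite /encP /permC odd_sigmatau tau_exp_sigmatau /= inordK.
Qed.

Definition valid (a : cgen) : bool :=
  match a with
  | CX t => t \in transps | CY t => t \in transps
  | CG g => g \in perms | CD g => g \in perms
  end.

(** Certificates are written in codes; a submodule is stable under them because valid codes come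
    from generators. *)
Lemma encK a : valid a -> exists x, enc x = a.
Proof.
case: a => [t|t|g|g] /= va.
- by exists (GenX (decT t)); rewrite /= encT_decT //; move: va; rewrite mem_iota.
- by exists (GenY (decT t)); rewrite /= encT_decT //; move: va; rewrite mem_iota.
- by exists (GenG (permC g)); rewrite /= encP_permC.
- by exists (GenD (permC g)); rewrite /= encP_permC.
Qed.

Section VermaCoordinates.
Variables (k : fieldType) (zeta : k).
Hypothesis zeta_eq : zeta ^+ 2 = - 1 - zeta.
Local Notation Mx := (Mx zeta).
Local Notation Mw := (Mw zeta).
Local Notation Mp := (Mp zeta).
Local Notation vec := (vec zeta).
Local Notation W := (verma (Msigma k)).
Local Notation velt := (@velt k).

(** The listed words are normal forms: applying the letters of one of them to |c> yields its basis
    vector without correction terms. *)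
Lemma check_words : all (fun j => seqv
  (pmono (map CX (nth [::] words (j %/ 3))) [:: (z1, j %% 3)%N]) [:: (z1, j)]) (iota 0 36).
Proof. by vm_compute. Qed.

Lemma coord_xword (f : {linear W -> Emod zeta_eq}) w c :
  (forall d t, f (@tens k (Msigma k) d (ket k t)) = d *: sE zeta_eq t) ->
  all (fun a => a < 3)%N w -> (c < 3)%N -> f (xword k w c) = Mw (map CX w) *m e_ k c.
Proof.
move=> fE w3 c3; elim: w w3 => [_|a w IH] /=.
  rewrite Mw_nil mul1mx; apply: etrans (fE _ _) _.
  by rewrite scale1r /sE encT_decT.
case/andP=> a3 w3; rewrite Mw_cons linearZ_LR IH // -mulmxA.
rewrite -[in CX a](encT_decT a3) /=.
exact: (GenE (GenX (decT a)) (Mw (map CX w) *m e_ k c : Emod zeta_eq)).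
Qed.

(** The map of [coord_exists] is a left inverse by [check_words]. For surjectivity, the range of
    [velt] is a submodule by [Gen_velt] and contains the generators 1 (x) |b>. *)
Lemma velt_bij : exists f : W -> 'cV[k]_36, cancel velt f /\ cancel f velt.
Proof.
have [f fE] := coord_exists zeta_eq.
have fK : cancel velt f.
  move=> v; rewrite linear_sum /= [RHS]col_sum; apply: eq_bigr => j _.
  rewrite linearZ_LR [LHS]kactEm; congr (_ *: _).
  rewrite coord_xword // ?words_lt3 ?ltn_mod // -(vece zeta (j %% 3)) (Mw_vec zeta_eq).
  rewrite -(vece zeta j).
  apply: seqvP; have /allP := check_words; apply.
  by rewrite mem_iota ltn_ord.
exists f; split=> // q.
have sub : submod setT (range velt).
  apply: submod_gen => [|a _ [v _ <-]]; last first.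
    by exists (Mx (enc a) *m v); rewrite // -(Gen_velt zeta_eq).
  split; first by exists 0; rewrite // velt0.
    by move=> _ _ [u _ <-] [v _ <-]; exists (u + v); rewrite // veltD.
  by move=> c _ [u _ <-]; exists (c *: u); rewrite // veltZ.
have [v <-] : exists v, velt v = q.
  have [u ->] := verma_span q; have [N0 ND NZ] := sub.
  suff [v _ <-] : range velt (\sum_b u b *: @tens k (Msigma k) 1 (ket k b)) by exists v.
  apply: (@ksub_sum k W (range velt) _ _ _ _ (submodT_ksub sub)) => b _; apply: NZ => //.
  exists (e_ k (encT b)); first by [].
  rewrite velt_vket; last exact: ltn_ord.
  by rewrite /vket decT_encT.
by rewrite fK.
Qed.

Lemma velt_inj : injective velt.
Proof. by have [f [fK _]] := velt_bij; apply: can_inj fK. Qed.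
Lemma velt_surj q : exists v, q = velt v.
Proof. by have [f [_ fK]] := velt_bij; exists (f q). Qed.

Lemma submod_Mw (N : set W) w v : submod setT N -> all valid w ->
  N (velt v) -> N (velt (Mw w *m v)).
Proof.
move=> [_ _ NZ] + Nv; elim: w => [|a w IH /= /andP[va vw]]; first by rewrite Mw_nil mul1mx.
have [x <-] := encK va; rewrite Mw_cons -mulmxA -(Gen_velt zeta_eq).
exact: (NZ _ _ I (IH vw)).
Qed.

Lemma submod_Mp (N : set W) p v : submod setT N -> all (fun x => all valid x.2) p ->
  N (velt v) -> N (velt (Mp p *m v)).
Proof.
move=> sN; have [N0 ND NZ] := submodT_ksub sN => + Nv.
elim: p => [|[c w] p IH /= /andP[vw vp]]; first by rewrite Mp_nil mul0mx velt0.
rewrite Mp_cons mulmxDl veltD -scalemxAl veltZ; apply: ND; last exact: IH vp.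
exact: NZ (submod_Mw sN vw Nv).
Qed.
End VermaCoordinates.

(** * The socle *)

Definition z3 : zz := (3, 0).

(** zeta^(-l) is written zeta^(2 l), so that only nonnegative powers occur. *)
Definition nvec_coord (l : nat) : svec :=
  sscale (zpow l) (pmono [:: CX 2; CX 0; CX 1] [:: (z1, 1%N)]) ++
  sscale (zpow (2 * l)) (pmono [:: CX 0; CX 2; CX 1] [:: (z1, 0%N)]) ++
  sscale zN1 (pmono [:: CX 0; CX 2; CX 0] [:: (z1, 2)]).
Definition rvec_coord : svec :=
  sscale zN1 (pmono [:: CX 0; CX 2] [:: (z1, 0%N)] ++
    pmono [:: CX 2; CX 1] [:: (z1, 0%N)]) ++
  sscale zN1 (pmono [:: CX 0; CX 1] [:: (z1, 2)] ++
    pmono [:: CX 2; CX 0] [:: (z1, 2)]).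

(* Coordinates of a basis of the socle: M_soc (0-2), N_1 (3-4), N_2 (5-6), R (7-9). *)
Definition sbas (i : nat) : svec :=
  match i with
  | 0 | 1 | 2 => [:: (z1, 33 + i)%N]
  | 3 => nvec_coord 1
  | 4 => slin (bG (true, 0%N)) (nvec_coord 1)
  | 5 => nvec_coord 2
  | 6 => slin (bG (true, 0%N)) (nvec_coord 2)
  | _ => slin (bG (false, (i - 5) %% 3)%N) rvec_coord
  end.

(* Coordinate functionals on the span of the [sbas i], multiplied by 3. *)
Definition sdual (i : nat) : svec :=
  match i with
  | 0 | 1 | 2 => [:: (z3, 33 + i)%N]
  | 3 => [:: (zpow 2, 31); (zmul zN1 (zpow 1), 24); (z1, 29)]
  | 4 => [:: (zpow 2, 32); (zpow 1, 27); (zN1, 25)]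
  | 5 => [:: (zpow 1, 31); (zmul zN1 (zpow 2), 24); (z1, 29)]
  | 6 => [:: (zpow 1, 32); (zpow 2, 27); (zN1, 25)]
  | 7 => [:: (z3, 13)]
  | 8 => [:: (z3, 23)]
  | _ => [:: (zmul zN1 z3, 12)]
  end.

Definition sdot (l l' : svec) : zz :=
  foldr (fun j acc => zadd (zmul (scoef l j) (scoef l' j)) acc) z0 (iota 0 36).

Definition cgens : seq cgen :=
  map CX transps ++ map CY transps ++ map CG perms ++ map CD perms.

(** For the indices 3 to 6 this is orthogonality of characters of Z/3: n_1 and n_2 have the same
    support, with coefficients zeta^l, zeta^(-l) and 1 up to sign, and 1 + zeta + zeta^2 = 0
    separates them. Hence the factor 3. *)
Lemma check_dual : all (fun i => all (fun j =>
  sdot (sdual i) (sbas j) == (if i == j then z3 else z0)) (iota 0 10)) (iota 0 10).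
Proof. by vm_compute. Qed.

(** Each image of a basis vector is compared with the combination predicted by the dual functionals,
    both sides tripled to stay in Z[zeta]. *)
Lemma check_stable : all (fun a => all (fun j =>
  let l := slin (bact a) (sbas j) in
  seqv (sscale z3 l)
    (flatten [seq sscale (sdot (sdual i) l) (sbas i) | i <- iota 0 10]))
  (iota 0 10)) cgens.
Proof. by vm_compute. Qed.

(* Frobenius duality: [qX i] maps the i-th word to the top word, and kills all other
   words of the same or of higher degree. *)
Definition qX (i : nat) : spoly :=
  nth [::] [::
    [:: (z1, [:: CX 0; CX 1; CX 0; CX 2])];
    [:: (zN1, [:: CX 1; CX 0; CX 2])];
    [:: (zN1, [:: CX 0; CX 1; CX 2])];
    [:: (z1, [:: CX 0; CX 1; CX 0])];
    [:: (z1, [:: CX 0; CX 2]); (z1, [:: CX 1; CX 0])];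
    [:: (z1, [:: CX 0; CX 1])];
    [:: (z1, [:: CX 0; CX 1]); (z1, [:: CX 1; CX 2])];
    [:: (z1, [:: CX 1; CX 0])];
    [:: (zN1, [:: CX 2])]; [:: (z1, [:: CX 1])]; [:: (z1, [:: CX 0])];
    [:: (z1, [::])]] i.

(* The factor delta_b isolates |b>, and a power of tau then moves it to |12>. *)
Definition qtop (j : nat) : spoly :=
  [seq (x.1, [:: CG (false, (3 - j %% 3) %% 3), CD (true, j %% 3) & x.2])%N
     | x <- qX (j %/ 3)].

(** One-sided, because [qtop j] is only applied to vectors whose coordinates before j vanish. The
    index 33 is that of x_top|12>. *)
Lemma check_qtop : all (fun j => all (fun x => all valid x.2) (qtop j) &&
  all (fun j' => (j <= j')%N ==>
    seqv (papp (qtop j) [:: (z1, j')])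
      (if j == j' then [:: (z1, 33%N)] else [::])) (iota 0 36)) (iota 0 36).
Proof. by vm_compute. Qed.

(* Takes [x_top|12>], which has index 33, to the i-th basis vector of the socle. *)
Definition qbas (i : nat) : spoly :=
  match i with
  | 0 | 1 | 2 => [:: (z1, [:: CG (false, i)])]
  | 3 => [:: (zN1, [:: CY 2]); (zpow 1, [:: CY 0; CG (false, 1%N)])]
  | 4 => [:: (zN1, [:: CG (true, 0%N); CY 2]);
             (zpow 1, [:: CG (true, 0%N); CY 0; CG (false, 1%N)])]
  | 5 => [:: (zN1, [:: CY 2]); (zpow 2, [:: CY 0; CG (false, 1%N)])]
  | 6 => [:: (zN1, [:: CG (true, 0%N); CY 2]);
             (zpow 2, [:: CG (true, 0%N); CY 0; CG (false, 1%N)])]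
  | _ => [:: (zN1, [:: CG (false, (i - 5) %% 3)%N; CY 0; CY 2])]
  end.

Lemma check_qbas : all (fun i => all (fun x => all valid x.2) (qbas i) &&
  seqv (papp (qbas i) [:: (z1, 33%N)]) (sbas i)) (iota 0 10).
Proof. by vm_compute. Qed.

Definition qword (j : nat) : spoly := [:: (z1, map CX (nth [::] words (j %/ 3)))].

(* The last part says that the i-th word raises a vector of positive degree to degree
   greater than that of the word. *)
Lemma check_qword : all (fun j => all (fun x => all valid x.2) (qword j) &&
  seqv (papp (qword j) [:: (z1, j %% 3)%N]) [:: (z1, j)] &&
  all (fun j' => let l := papp (qword j) [:: (z1, j')] in
    all (fun j'' => scoef l j'' == z0) (iota 0 j.+1)) (iota 3 33))
  (iota 0 36).
Proof. by vm_compute. Qed.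

(** In degree 0, the idempotent keeps only |b>, and tau^(c - b) carries it to |c>; parts of positive
    degree stay there. *)
Definition qrot (b c : nat) : spoly :=
  [:: (z1, [:: CG (false, (c + 3 - b) %% 3)%N; CD (true, b)])].

Lemma check_qrot : all (fun b => all (fun c =>
  all (fun x => all valid x.2) (qrot b c) &&
  all (fun j => let l := papp (qrot b c) [:: (z1, j)] in
    all (fun c' => scoef l c' == if (j == b) && (c' == c) then z1 else z0) transps)
  (iota 0 36)) transps) transps.
Proof. by vm_compute. Qed.

(** M_soc starts at 0 and R at 7 in [sbas]; both triples, indexed by transposition codes, transform
    like the |ij> of M(sigma,-). *)
Lemma check_sigma : all (fun o => all (fun c =>
    all (fun g => seqv (slin (bG g) (sbas (o + c)%N))
      (sscale (csgn g) (sbas (o + crack g c)%N))) perms &&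
    all (fun h => seqv (slin (bD h) (sbas (o + c)%N))
      (if (true, c) == h then sbas (o + c)%N else [::])) perms)
  transps) [:: 0; 7]%N.
Proof. by vm_compute. Qed.

Lemma check_Yr : all (fun t => all (fun c =>
  seqv (slin (bY t) (sbas (7 + c)%N)) [::]) transps) transps.
Proof. by vm_compute. Qed.

(** N_l starts at 1 + 2 l in [sbas], with |tau> before |tau^-1>. The factor 2 in the exponent
    replaces a minus sign, and (false, 2) codes tau^-1. *)
Lemma check_tau : all (fun l => all (fun b : bool =>
    all (fun g => seqv (slin (bG g) (sbas (1 + 2 * l + ~~ b)%N))
      (sscale (zpow ((if b then 1 else 2) * l * g.2)%N)
         (sbas (1 + 2 * l + ~~ (g.1 (+) b))%N))) perms &&
    all (fun h => seqv (slin (bD h) (sbas (1 + 2 * l + ~~ b)%N))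
      (if (false, if b then 1%N else 2) == h
       then sbas (1 + 2 * l + ~~ b)%N else [::])) perms)
  [:: true; false]) [:: 1; 2]%N.
Proof. by vm_compute. Qed.

Fixpoint letters (n : nat) : seq (seq nat) :=
  if n is n'.+1 then [seq a :: w | a <- transps, w <- letters n'] else [:: [::]].

(** Each of the 81 words of length 4 is a multiple of the top word, so B^4(V) (x) |c> is spanned by
    x_top|c>. *)
Lemma check_deg4 : all (fun c => all (fun w =>
    let l := pmono (map CX w) [:: (z1, c)] in
    seqv l (sscale (scoef l (33 + c)%N) (sbas c)))
  (letters 4)) transps.
Proof. by vm_compute. Qed.

Lemma sbas3 : sbas 3 = nvec_coord 1. Proof. by []. Qed.
Lemma sbas5 : sbas 5 = nvec_coord 2. Proof. by []. Qed.
Lemma check_rvec : seqv (sbas 8) rvec_coord. Proof. by vm_compute. Qed.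
Lemma check_top : all (fun c =>
  seqv (pmono (map CX [:: 0; 1; 0; 2]%N) [:: (z1, c)]) (sbas c)) transps.
Proof. by vm_compute. Qed.
(** The vector r has degree (23), of code 1; since 1 + c + 2 = c modulo 3, tau^(c + 2) carries it to
    the vector of R of code c. *)
Lemma crack_rot : all (fun c => crack (false, (c + 2) %% 3)%N 1 == c) transps.
Proof. by []. Qed.

Lemma perms_even n : (n < 3)%N -> (false, n) \in perms.
Proof. by case: n => [|[|[|//]]]. Qed.

Opaque sbas sdual velt xword vbas.

Section Socle.
Variables (k : fieldType) (zeta : k).
Hypothesis zeta_eq : zeta ^+ 2 = - 1 - zeta.
Hypothesis three_neq0 : 3 != 0 :> k.
Local Notation Mx := (Mx zeta).
Local Notation Mp := (Mp zeta).
Local Notation vec := (vec zeta).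
Local Notation W := (verma (Msigma k)).
Local Notation velt := (@velt k).

Lemma phi_3 : phi zeta z3 = 3.
Proof. by rewrite /phi mul0r addr0. Qed.

Definition comb (c : 'I_10 -> k) : 'cV[k]_36 := \sum_i c i *: vec (sbas i).
Definition lam (i : nat) (v : 'cV[k]_36) : k := \sum_j vec (sdual i) j 0 * v j 0.

Lemma lam_vec i l : lam i (vec l) = phi zeta (sdot (sdual i) l).
Proof.
rewrite /lam; under eq_bigr do rewrite !vec_coef -(phiM zeta_eq).
rewrite -(big_mkord xpredT (fun j => phi zeta (zmul (scoef (sdual i) j) (scoef l j)))).
rewrite /index_iota subn0 /sdot; elim: (iota 0 36) => [|j js IH].
  by rewrite big_nil phi_0.
by rewrite big_cons IH /= phiD.
Qed.

Lemma lamD i u v : lam i (u + v) = lam i u + lam i v.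
Proof. by rewrite /lam -big_split; apply: eq_bigr => j _; rewrite mxE mulrDr. Qed.
Lemma lamZ i c v : lam i (c *: v) = c * lam i v.
Proof. by rewrite /lam mulr_sumr; apply: eq_bigr => j _; rewrite mxE mulrCA. Qed.
Lemma lam0 i : lam i 0 = 0.
Proof. by rewrite -(scale0r 0) lamZ mul0r. Qed.

Lemma lam_comb c (i : 'I_10) : lam i (comb c) = c i * 3.
Proof.
rewrite /comb (big_morph _ (lamD i) (lam0 i)) (bigD1 i) //= big1 => [|j ij].
  rewrite addr0 lamZ lam_vec; congr (_ * _); rewrite -phi_3.
  have /allP/(_ i)/(_ _)/allP/(_ i) := check_dual.
  by rewrite mem_iota ltn_ord eqxx => /(_ isT isT)/eqP ->.
rewrite lamZ lam_vec.
have /allP/(_ i)/(_ _)/allP/(_ j) := check_dual.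
rewrite !mem_iota !ltn_ord => /(_ isT isT).
have -> : (i == j :> nat) = false by apply/eqP => e; case/eqP: ij; apply: val_inj.
by move=> /eqP ->; rewrite phi_0 mulr0.
Qed.

Lemma comb_inj c d : comb c = comb d -> c =1 d.
Proof.
move=> e i; have /(congr1 (lam i)) := e; rewrite !lam_comb; exact: mulIf.
Qed.

Lemma combD c d : comb (fun i => c i + d i) = comb c + comb d.
Proof. by rewrite -big_split; apply: eq_bigr => i _; rewrite scalerDl. Qed.
Lemma combZ a c : comb (fun i => a * c i) = a *: comb c.
Proof. by rewrite /comb scaler_sumr; apply: eq_bigr => i _; rewrite scalerA. Qed.
Lemma comb0 : comb (fun=> 0) = 0.
Proof. by rewrite /comb big1 // => i _; rewrite scale0r. Qed.

(** The summand to which [sbas i] belongs: 0 for M_soc, l for N_l, 3 for R. *)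
Definition blk (i : nat) : nat :=
  if (i < 3)%N then 0%N else if (i < 5)%N then 1%N else if (i < 7)%N then 2%N else 3.

Definition block (B : nat) : set W :=
  [set velt (comb c) | c in [set c | forall i : 'I_10, blk i != B -> c i = 0]].
Definition soc : set W := [set velt (comb c) | c in [set: 'I_10 -> k]].

Lemma soc_ksub : ksub soc.
Proof.
split; first by exists (fun=> 0); rewrite // comb0 velt0.
  move=> _ _ [c _ <-] [d _ <-]; exists (fun i => c i + d i) => //.
  by rewrite combD veltD.
by move=> a _ [c _ <-]; exists (fun i => a * c i); rewrite // combZ veltZ.
Qed.

Lemma all_cgens (P : pred cgen) x : all P cgens -> P (enc x).
Proof.
rewrite /cgens !all_cat !all_map => /and4P[/allP PX /allP PY /allP PG /allP PD].
case: x => x; [apply: PX|apply: PY|apply: PG|apply: PD];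
  exact: encT_transps || exact: encP_perms.
Qed.

Lemma soc_submod : submod setT soc.
Proof.
have [S0 SD SZ] := soc_ksub.
apply: submod_gen => [//|x _ [c _ <-]]; rewrite (Gen_velt zeta_eq) /comb mulmx_sumr velt_sum.
apply: (@ksub_sum k W soc _ _ _ _ soc_ksub) => j _; rewrite -scalemxAr veltZ; apply: SZ.
have /(@all_cgens _ x)/allP/(_ j) := check_stable.
rewrite mem_iota ltn_ord => /(_ isT)/(seqvP zeta).
rewrite (vec_scale zeta_eq) phi_3 vec_flatten big_map (Mx_vec zeta_eq).
set l := slin _ _ => e.
(* The dual functionals return three times the coefficients. *)
exists (fun i : 'I_10 => 3^-1 * phi zeta (sdot (sdual i) l)); first by [].
rewrite combZ; congr velt; apply: (scalerI three_neq0); rewrite scalerA divff // scale1r e.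
rewrite -[iota 0 10]/(index_iota 0 10) big_mkord; apply: eq_bigr => i _.
by rewrite (vec_scale zeta_eq).
Qed.

(** Frobenius duality applied to the lowest term: for the first nonzero coordinate j, [qtop j] kills
    the components after j and leaves a nonzero multiple of x_top|12>. *)
Lemma submod_top N : submod setT N -> N <> [set 0] -> N (velt (e_ k 33)).
Proof.
move=> sN N0.
have [v [Nv v0]] : exists v, N (velt v) /\ v <> 0.
  apply: contrapT => h; apply: N0; apply/seteqP; split=> [q Nq|_ ->]; last by case: sN.
  have [v ev] := velt_surj zeta_eq q; case: (eqVneq v 0) => [v0|/eqP v0].
    by rewrite ev v0 velt0.
  by case: h; exists v; rewrite -ev.
have ex : exists n, (n < 36)%N && (v (inord n) 0 != 0).
  apply: contrapT => h; apply: v0; apply/colP => i; rewrite mxE; apply/eqP.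
  by apply: contrapT => /negP vi; apply: h; exists i; rewrite ltn_ord inord_val.
case: (ex_minnP ex) => j /andP[jlt vj] jmin.
have /allP/(_ j) := check_qtop; rewrite mem_iota => /(_ jlt)/andP[vq /allP cq].
have e : Mp (qtop j) *m v = v (inord j) 0 *: e_ k 33.
  rewrite {1}(col_sum v) mulmx_sumr (bigD1 (inord j) isT) big1 => [|i /= ij].
    rewrite /= addr0 -scalemxAr -(vece zeta) (Mp_vec zeta_eq) inordK //.
    have /implyP/(_ (leqnn j))/(seqvP zeta) -> : (j <= j)%N ==>
        seqv (papp (qtop j) [:: (z1, j)]) (if j == j then [:: (z1, 33%N)] else [::]).
      by apply: cq; rewrite mem_iota.
    by rewrite eqxx vece.
  have [lt|ge] := ltnP i j.
    case: (eqVneq (v i 0) 0) => [->|vi]; first by rewrite scale0r mulmx0.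
    by have := jmin i; rewrite ltn_ord inord_val vi leqNgt lt => /(_ isT).
  rewrite -scalemxAr -(vece zeta) (Mp_vec zeta_eq).
  have := cq i; rewrite mem_iota ltn_ord ge => /(_ isT) /= /(seqvP zeta) ->.
  case: eqP => [ji|_]; last by rewrite [vec _]big_nil scaler0.
  by case/eqP: ij; apply: val_inj; rewrite /= inordK.
rewrite -(scalerK vj (e_ k 33)) -e veltZ; have [_ _ NZ] := submodT_ksub sN.
exact: NZ (submod_Mp zeta_eq sN vq Nv).
Qed.

Lemma submod_soc N : submod setT N -> N <> [set 0] -> soc `<=` N.
Proof.
move=> sN N0 _ [c _ <-]; have top := submod_top sN N0; rewrite /comb velt_sum.
have [_ _ NZ] := submodT_ksub sN.
apply: (@ksub_sum k W N _ _ _ _ (submodT_ksub sN)) => i _; rewrite veltZ; apply: NZ.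
have /allP/(_ i) := check_qbas; rewrite mem_iota ltn_ord => /(_ isT)/andP[vq e].
have := submod_Mp zeta_eq sN vq top.
by rewrite -(vece zeta) (Mp_vec zeta_eq) (seqvP zeta e).
Qed.

Lemma soc_neq0 : soc <> [set 0].
Proof.
move=> e; have : soc (velt (comb (fun=> 1))) by exists (fun=> 1).
rewrite e -(velt0 k) => /(velt_inj zeta_eq); rewrite -comb0 => /comb_inj/(_ ord0)/eqP.
by rewrite oner_eq0.
Qed.

Lemma soc_simple : simple_submod soc.
Proof.
split; [exact: soc_submod|exact: soc_neq0|] => N sN Nsoc.
have [->|N0] := EM (N = [set 0]); first by left.
by right; apply/seteqP; split=> //; apply: submod_soc.
Qed.

Lemma socleE : socle W = soc.
Proof.
apply/seteqP; split=> [q|q sq]; last first.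
  by move=> N [sN NG]; apply: NG; exists soc => //; apply: soc_simple.
apply; split; first exact: soc_submod.
move=> u [N [sN N0 simpN] Nu]; have sS := submod_soc sN N0.
by have [/soc_neq0 //|->] := simpN _ soc_submod sS.
Qed.
End Socle.

(** * The four summands as D(S_3)-modules *)

Definition isig (o : nat) (t : transp) : 'I_10 := inord (o + encT t).

Lemma val_isig o t : o \in [:: 0; 7]%N -> isig o t = (o + encT t)%N :> nat.
Proof.
have : (encT t < 3)%N by exact: ltn_ord.
by rewrite /isig !inE => t3 /orP[]/eqP ->; rewrite inordK //; lia.
Qed.

Lemma isig_inj o : o \in [:: 0; 7]%N -> injective (isig o).
Proof.
move=> o07 t u /(congr1 val); rewrite /= !val_isig // => /addnI; exact: encT_inj.
Qed.

Section Blocks.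
Variables (k : fieldType) (zeta : k).
Hypothesis zeta_eq : zeta ^+ 2 = - 1 - zeta.
Hypothesis three_neq0 : 3 != 0 :> k.
Local Notation Mx := (Mx zeta).
Local Notation vec := (vec zeta).
Local Notation comb := (comb zeta).
Local Notation block := (block zeta).
Local Notation soc := (soc zeta).
Local Notation W := (verma (Msigma k)).
Local Notation velt := (@velt k).

Lemma block_sub_soc B : block B `<=` soc.
Proof. by move=> _ [c _ <-]; exists c. Qed.

Section Block.
Variables (M : dsmod k) (B : nat) (i_ : dsbasis M -> 'I_10).
Hypothesis i_inj : injective i_.
Hypothesis i_blk : forall b, blk (i_ b) = B.
Hypothesis i_surj : forall i : 'I_10, blk i = B -> exists b, i_ b = i.

Definition bvec b : W := velt (vec (sbas (i_ b))).

Hypothesis bG : forall g b, Gr k g *: bvec b = flin bvec (dsact g b).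
Hypothesis bD : forall h b, Dl k h *: bvec b = if dsdeg b == h then bvec b else 0.

(** At most one term survives, [i_] being injective; off the block the sum is empty, which supplies
    the zero coefficients. *)
Definition bcoef (m : dscar M) (i : 'I_10) : k := \sum_(b | i_ b == i) (m b : k).

Lemma flin_bvec m : flin bvec m = velt (comb (bcoef m)).
Proof.
rewrite /flin; under eq_bigr do rewrite -veltZ; rewrite -velt_sum; congr velt.
rewrite (partition_big i_ xpredT) //=; apply: eq_bigr => i _.
by rewrite scaler_suml; apply: eq_bigr => b /eqP ->.
Qed.

Lemma bcoef_i m b : bcoef m (i_ b) = m b.
Proof. by rewrite /bcoef (big_pred1 b) // => b'; rewrite (inj_eq i_inj). Qed.

Lemma range_bvec : range (flin bvec) = block B.
Proof.
apply/seteqP; split=> [_ [m _ <-]|_ [c cB <-]].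
  exists (bcoef m); last exact: esym (flin_bvec m).
  move=> i iB; rewrite /bcoef big1 // => b /eqP bi.
  by case/eqP: iB; rewrite -bi i_blk.
exists ([ffun b => c (i_ b)] : dscar M); first by [].
rewrite flin_bvec; congr velt; apply: eq_bigr => i _; congr (_ *: _).
case: (eqVneq (blk i) B) => [/i_surj[b <-]|iB]; first by rewrite bcoef_i ffunE.
rewrite cB // /bcoef big1 // => b /eqP bi.
by case/eqP: iB; rewrite -bi i_blk.
Qed.

Lemma bvec_block b : block B (bvec b).
Proof. by rewrite -range_bvec; exists (ket k b); [|apply: flin_ket]. Qed.

Lemma block_iso : ds_iso (block B) M.
Proof.
exists (flin bvec); split;
  [exact: flin_linear|exact: flinG|exact: flinD| |exact: range_bvec].
move=> m m'; rewrite !flin_bvec => /(velt_inj zeta_eq)/(comb_inj zeta_eq three_neq0) e.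
by apply/ffunP => b; have := e (i_ b); rewrite !bcoef_i.
Qed.

Lemma block_DS3 : submod (DS3 k) (block B).
Proof.
rewrite -range_bvec; apply: submod_DS3.
- split; first by exists 0; rewrite // flin0.
    move=> _ _ [m _ <-] [m' _ <-]; exists (m + m'); first by [].
    by have := flin_linear bvec 1 m m'; rewrite scale1r kact1.
  by move=> c _ [m _ <-]; exists (c *: m); rewrite // flinZ.
- by move=> g _ [m _ <-]; exists (actG g m); rewrite // flinG.
by move=> h _ [m _ <-]; exists (actD h m); rewrite // flinD.
Qed.

Lemma block_gen (b0 : dsbasis M) :
  (forall b, exists c g, bvec b = c **: (Gr k g *: bvec b0)) ->
  genmod (DS3 k) [set bvec b0] = block B.
Proof.
move=> gen; apply/seteqP; split=> [q|].
  apply; split; first exact: block_DS3.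
  move=> _ ->; rewrite -range_bvec; exists (ket k b0) => //.
  exact: flin_ket.
rewrite -range_bvec => _ [m _ <-] N [sN Nb0].
have kN := DS3_ksub sN; have [N0 ND NZ] := kN.
apply: (@ksub_sum k W N _ _ _ _ kN) => b _; apply: (NZ).
have [c [g ->]] := gen b; apply: NZ; have [_ _ NA] := sN; apply: NA.
  by move=> S [_ SG]; apply: SG; left; exists g.
exact: Nb0.
Qed.
End Block.

Lemma slin_G g l : Gr k g *: velt (vec l) = velt (vec (slin (bG (encP g)) l)).
Proof. by rewrite (G_velt zeta_eq) (Mx_vec zeta_eq). Qed.
Lemma slin_D h l : Dl k h *: velt (vec l) = velt (vec (slin (bD (encP h)) l)).
Proof. by rewrite (D_velt zeta) (Mx_vec zeta_eq). Qed.
Lemma slin_Y t l : Y k t *: velt (vec l) = velt (vec (slin (bY (encT t)) l)).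
Proof. by rewrite (Y_velt zeta_eq) (Mx_vec zeta_eq). Qed.

Section SigmaBlock.
Variable o : nat.
Hypothesis o07 : o \in [:: 0; 7]%N.

Lemma sigma_G g t : Gr k g *: @bvec (Msigma k) (isig o) t =
  flin (@bvec (Msigma k) (isig o)) (@dsact _ (Msigma k) g t).
Proof.
rewrite /= /sigma_act flinZ flin_ket /bvec !(val_isig _ o07) slin_G.
have /allP/(_ _ o07)/allP/(_ _ (encT_transps t))/andP[/allP/(_ _ (encP_perms g)) + _] :=
  check_sigma.
by move=> /(seqvP zeta) ->; rewrite (vec_scale zeta_eq) veltZ phi_csgn encT_conj.
Qed.

Lemma sigma_D h t : Dl k h *: @bvec (Msigma k) (isig o) t =
  if val t == h then @bvec (Msigma k) (isig o) t else 0.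
Proof.
rewrite /bvec !(val_isig _ o07) slin_D.
have /allP/(_ _ o07)/allP/(_ _ (encT_transps t))/andP[_ /allP/(_ _ (encP_perms h))] :=
  check_sigma.
move=> /(seqvP zeta) ->; rewrite -encP_val (inj_eq encP_inj); case: eqP => // _.
by rewrite [vec _]big_nil velt0.
Qed.
End SigmaBlock.
End Blocks.

Lemma encT_t12 : encT t12 = 0%N. Proof. exact: (@encT_decT 0). Qed.
Lemma encT_t23 : encT t23 = 1%N. Proof. exact: (@encT_decT 1). Qed.
Lemma encT_t13 : encT t13 = 2%N. Proof. exact: (@encT_decT 2). Qed.

Lemma encP_tau : encP tau = (false, 1%N).
Proof. by rewrite /encP odd_tau /tau_exp odd_tau; have [-> _ _] := tauE. Qed.

Lemma blk_isig0 t : blk (isig 0 t) = 0%N.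
Proof. by rewrite val_isig // /blk add0n ltn_ord. Qed.
Lemma blk_isig7 t : blk (isig 7 t) = 3%N.
Proof. by rewrite val_isig. Qed.
Lemma isig0_surj (i : 'I_10) : blk i = 0%N -> exists t, isig 0 t = i.
Proof.
move=> bi; have i3 : (i < 3)%N by move: bi; rewrite /blk; do 3! case: ifP => //.
by exists (decT i); apply: val_inj; rewrite /= val_isig // encT_decT.
Qed.
Lemma isig7_surj (i : 'I_10) : blk i = 3%N -> exists t, isig 7 t = i.
Proof.
move=> bi; have i7 : (7 <= i)%N.
  rewrite leqNgt; apply/negP => i7; move: bi; rewrite /blk i7.
  by case: ifP => // _; case: ifP.
exists (decT (i - 7)); apply: val_inj; rewrite /= val_isig // encT_decT ?subnKC //.
by rewrite ltn_subLR.
Qed.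

Definition itau (l : nat) (b : bool) : 'I_10 := inord (1 + 2 * l + ~~ b).

Lemma val_itau l b : l \in [:: 1; 2]%N -> itau l b = (1 + 2 * l + ~~ b)%N :> nat.
Proof. by rewrite /itau !inE => /orP[] /eqP ->; rewrite inordK //; case: b. Qed.
Lemma itau_inj l : l \in [:: 1; 2]%N -> injective (itau l).
Proof. by move=> l12 [] [] // /(congr1 val) /=; rewrite !val_itau // => /addnI. Qed.
Lemma blk_itau l b : l \in [:: 1; 2]%N -> blk (itau l b) = l.
Proof.
by move=> l12; rewrite val_itau //; move: l12; rewrite !inE => /orP[] /eqP ->; case: b.
Qed.
Lemma itau_surj l (i : 'I_10) : l \in [:: 1; 2]%N -> blk i = l -> exists b, itau l b = i.
Proof.
(* In each of the pairs 3, 4 and 5, 6 the odd index is that of |tau>. *)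
move=> l12 bi; exists (odd i); apply: val_inj; rewrite /= val_itau //; rewrite -bi.
by move: l12; rewrite -bi; case: i {bi} => -[|[|[|[|[|[|[|[|[|[|//]]]]]]]]]].
Qed.

Section Identification.
Variables (k : fieldType) (zeta : k) (zeta_prim : 3.-primitive_root zeta).

(** zeta^3 - 1 = (zeta - 1)(zeta^2 + zeta + 1), and primitivity excludes zeta = 1. *)
Lemma prim3_eq : zeta ^+ 2 = - 1 - zeta.
Proof.
have z3 : zeta ^+ 3 = 1 := prim_expr_order zeta_prim.
have z1 : zeta - 1 != 0.
  rewrite subr_eq0; apply/eqP => z1.
  have := eq_prim_root_expr zeta_prim 1 0; rewrite expr1 expr0 z1 eqxx => /esym.
  by [].
apply: (mulfI z1).
have -> : (zeta - 1) * zeta ^+ 2 = (zeta - 1) * (- 1 - zeta) + (zeta ^+ 3 - 1) by ring.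
by rewrite z3 subrr addr0.
Qed.
Let zeta_eq := prim3_eq.

Local Notation Mx := (Mx zeta).
Local Notation vec := (vec zeta).
Local Notation block := (block zeta).
Local Notation W := (verma (Msigma k)).
Local Notation velt := (@velt k).
Local Notation bsig o := (@bvec k zeta (Msigma k) (isig o)).

Lemma zetaV l : zeta ^- l = zeta ^+ (2 * l).
Proof.
have z3 : zeta ^+ 3 = 1 := prim_expr_order zeta_prim.
have zu : zeta \is a GRing.unit by apply/unitrPr; exists (zeta ^+ 2); rewrite -exprS.
apply: (mulrI (unitrX l zu)); rewrite divrr ?unitrX // -exprD.
by rewrite -{1}[l]mul1n -mulnDl exprM z3 expr1n.
Qed.

Section TauBlock.
Variable l : nat.
Hypothesis l12 : l \in [:: 1; 2]%N.
Local Notation btau := (@bvec k zeta (Mtau zeta_prim l) (itau l)).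

Lemma tau_G g b : Gr k g *: btau b = flin btau (@dsact _ (Mtau zeta_prim l) g b).
Proof.
rewrite /= /tau_act flinZ flin_ket /bvec !(val_itau _ l12) (slin_G zeta_eq).
have bin : b \in [:: true; false] by case: b.
have /allP/(_ _ l12)/allP/(_ _ bin)/andP[/allP/(_ _ (encP_perms g)) + _] := check_tau.
move=> /(seqvP zeta) ->; rewrite (vec_scale zeta_eq) veltZ (phi_pow zeta_eq).
have -> : (if b then zeta ^+ l else zeta ^- l) ^+ tau_exp g =
    zeta ^+ ((if b then 1%N else 2%N) * l * (encP g).2).
  by case: b {bin}; rewrite ?zetaV ?mul1n -exprM.
by [].
Qed.

Lemma tau_D h b : Dl k h *: btau b =
  if @dsdeg _ (Mtau zeta_prim l) b == h then btau b else 0.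
Proof.
rewrite /bvec !(val_itau _ l12) (slin_D zeta_eq).
have bin : b \in [:: true; false] by case: b.
have /allP/(_ _ l12)/allP/(_ _ bin)/andP[_ /allP/(_ _ (encP_perms h))] := check_tau.
move=> /(seqvP zeta) ->.
have -> : (false, if b then 1%N else 2) = encP (@dsdeg _ (Mtau zeta_prim l) b).
  by case: b {bin}; rewrite /= ?encPV encP_tau.
rewrite (inj_eq encP_inj); case: eqP => // _.
by rewrite [vec _]big_nil velt0.
Qed.
End TauBlock.
End Identification.

Opaque t12 t23 t13 X Y Gr Dl.

(** * The submodules M_soc, N_l and R as blocks *)

Lemma encT_letters (s : seq transp) : map encT s \in letters (size s).
Proof.
elim: s => [//|t s IH]; apply/allpairsP; exists (encT t, map encT s).
by split=> //; apply: encT_transps.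
Qed.

Section Submodules.
Variables (k : fieldType) (zeta : k) (zeta_prim : 3.-primitive_root zeta).
Hypothesis three_neq0 : 3 != 0 :> k.
Let zeta_eq := prim3_eq zeta_prim.
Local Notation vec := (vec zeta).
Local Notation block := (block zeta).
Local Notation W := (verma (Msigma k)).
Local Notation velt := (@velt k).
Local Notation bsig o := (@bvec k zeta (Msigma k) (isig o)).
Local Notation btau l := (@bvec k zeta (Mtau zeta_prim l) (itau l)).
Local Notation "x |> t" := (@tens k (Msigma k) x (ket k t)) (at level 45, no associativity).

Lemma tens1_velt t : 1 |> t = velt (e_ k (encT t)).
Proof. by rewrite velt_vket; [rewrite /vket decT_encT|exact: ltn_ord]. Qed.

Lemma slin_X t l : X k t *: velt (vec l) = velt (vec (pmono [:: CX (encT t)] l)).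
Proof. by apply: etrans (X_velt zeta _ _) _; rewrite (Mx_vec zeta_eq). Qed.

Lemma prodX_velt (s : seq transp) l :
  (\prod_(t <- s) X k t) *: velt (vec l) = velt (vec (pmono (map CX (map encT s)) l)).
Proof.
elim: s => [|t s IH]; first by rewrite big_nil scale1r.
by rewrite big_cons -(scalerA (X k t)) IH; apply: slin_X.
Qed.

Lemma tens_prodX (s : seq transp) t :
  (\prod_(u <- s) X k u) |> t =
  velt (vec (pmono (map CX (map encT s)) [:: (z1, encT t)])).
Proof. by rewrite tens1 tens1_velt -(vece zeta) prodX_velt. Qed.

Lemma tensD_l (d d' : alg k) t : (d + d') |> t = d |> t + d' |> t.
Proof. by rewrite tens1 scalerDl -!tens1. Qed.
Lemma tensZ_l c (d : alg k) t : (c *: d) |> t = c **: (d |> t).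
Proof. by rewrite tens1 kactAl -tens1. Qed.

Lemma tens_XX a b t : (X k a * X k b) |> t =
  velt (vec (pmono [:: CX (encT a); CX (encT b)] [:: (z1, encT t)])).
Proof. by have := tens_prodX [:: a; b] t; rewrite !big_cons big_nil mulr1. Qed.
Lemma tens_XXX a b c t : (X k a * X k b * X k c) |> t =
  velt (vec (pmono [:: CX (encT a); CX (encT b); CX (encT c)] [:: (z1, encT t)])).
Proof. by have := tens_prodX [:: a; b; c] t; rewrite !big_cons big_nil mulr1 mulrA. Qed.

Lemma tens_XXD a b c d t : (X k a * X k b + X k c * X k d) |> t =
  velt (vec (pmono [:: CX (encT a); CX (encT b)] [:: (z1, encT t)])) +
  velt (vec (pmono [:: CX (encT c); CX (encT d)] [:: (z1, encT t)])).
Proof. by rewrite tensD_l; congr (_ + _); apply: tens_XX. Qed.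
Lemma tens_ZXXX z a b c t : (z *: (X k a * X k b * X k c)) |> t =
  z **: velt (vec (pmono [:: CX (encT a); CX (encT b); CX (encT c)] [:: (z1, encT t)])).
Proof. by rewrite tensZ_l tens_XXX. Qed.

Lemma velt_quad p1 p2 p3 p4 :
  velt (vec (sscale zN1 (p1 ++ p2) ++ sscale zN1 (p3 ++ p4))) =
  - (velt (vec p1) + velt (vec p2)) - (velt (vec p3) + velt (vec p4)).
Proof.
rewrite vec_cat !(vec_scale zeta_eq) phi_N1 !scaleN1r 2!vec_cat.
by rewrite veltD !veltN !veltD.
Qed.
Lemma velt_triple l p1 p2 p3 :
  velt (vec (sscale (zpow l) p1 ++ sscale (zpow (2 * l)) p2 ++ sscale zN1 p3)) =
  zeta ^+ l **: velt (vec p1) + zeta ^- l **: velt (vec p2) - velt (vec p3).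
Proof.
rewrite 2!vec_cat !(vec_scale zeta_eq) phi_N1 !(phi_pow zeta_eq) scaleN1r.
by rewrite veltD veltD veltN 2!veltZ (zetaV zeta_prim) addrA.
Qed.

Lemma rvecE : rvec k = bsig 7 t23.
Proof.
rewrite /bvec val_isig // encT_t23 (seqvP zeta check_rvec).
apply: etrans (congr2 (fun u v => - u - v) (tens_XXD t12 t13 t13 t23 t12)
  (tens_XXD t12 t23 t13 t12 t13)) _.
by rewrite encT_t12 encT_t13 encT_t23; apply: esym (velt_quad _ _ _ _).
Qed.

Lemma nvecE l : l \in [:: 1; 2]%N -> nvec zeta l = btau l true.
Proof.
move=> l12; have -> : btau l true = velt (vec (nvec_coord l)).
  rewrite /bvec (val_itau _ l12); move: l12.
  by rewrite !inE => /orP[] /eqP ->; rewrite /= ?sbas3 ?sbas5.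
apply: etrans (congr2 (fun u v => u - v) (congr2 +%R
  (tens_ZXXX (zeta ^+ l) t13 t12 t23 t23) (tens_ZXXX (zeta ^- l) t12 t13 t23 t12))
  (tens_XXX t12 t13 t12 t13)) _.
by rewrite encT_t12 encT_t13 encT_t23; apply: esym (velt_triple _ _ _ _).
Qed.

Lemma Rmod_block : Rmod k = block 3.
Proof.
rewrite /Rmod rvecE; apply: block_gen.
- exact: isig_inj.
- exact: blk_isig7.
- exact: isig7_surj.
- exact: sigma_G.
- exact: sigma_D.
move=> t; pose g := permC (false, (encT t + 2) %% 3)%N.
have eg : encP g = (false, (encT t + 2) %% 3)%N.
  by apply: encP_permC; apply: perms_even; rewrite ltn_mod.
exists 1, g; rewrite kact1 sigma_G // /= /sigma_act flinZ flin_ket.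
have -> : sgn k g = 1 by rewrite /sgn; case: eg => -> _.
rewrite kact1; congr (bsig 7 _); apply: encT_inj; rewrite encT_conj eg encT_t23.
by have /allP/(_ _ (encT_transps t))/eqP := crack_rot.
Qed.

Lemma Nmod_block l : l \in [:: 1; 2]%N -> Nmod zeta l = block l.
Proof.
move=> l12; rewrite /Nmod nvecE //; apply: block_gen.
- exact: itau_inj.
- by move=> b; apply: blk_itau.
- by move=> i; apply: itau_surj.
- exact: tau_G.
- exact: tau_D.
(* sigma = (12) exchanges |tau> and |tau^-1>, hence takes n_l to the second basis vector. *)
move=> b; exists 1, (if b then 1%g else val t12); rewrite kact1 tau_G //.
case: b; first by rewrite dsact1 flin_ket.
rewrite /= /tau_act -/(encT t12) encT_t12 expr0 scale1r flin_ket.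
by rewrite (valP t12).
Qed.

Lemma block0_bvec t : block 0 (velt (vec (sbas (encT t)))).
Proof.
have := @bvec_block k zeta (Msigma k) 0 (isig 0) (@isig_inj 0 isT) blk_isig0 isig0_surj t.
by rewrite /bvec val_isig.
Qed.

Lemma block_ksub B : ksub (block B).
Proof.
split; first by exists (fun=> 0); rewrite // comb0 velt0.
  move=> _ _ [c cB <-] [d dB <-]; exists (fun i => c i + d i).
    by move=> i iB; rewrite cB // dB // addr0.
  by rewrite combD veltD.
move=> a _ [c cB <-]; exists (fun i => a * c i); last by rewrite combZ veltZ.
by move=> i iB; rewrite cB // mulr0.
Qed.

Lemma Bdeg_block0 (b : alg k) t : Bdeg k 4 b -> block 0 (b |> t).
Proof.
move=> /(_ [set b | block 0 (b |> t)]); have [N0 ND NZ] := block_ksub 0.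
apply; split; first split => [|u v Nu Nv|c u _ Nu] /=.
- by rewrite tens1 scale0r.
- by rewrite (tensD_l u v); apply: ND Nu Nv.
- by rewrite (tensZ_l c u); apply: NZ Nu.
move=> _ [s _ <-] /=; rewrite tens_prodX.
have /allP/(_ _ (encT_transps t))/allP/(_ (map encT s)) := check_deg4.
have -> : map encT s \in letters 4 by have := encT_letters s; rewrite size_tuple.
move=> /(_ isT)/(seqvP zeta) ->; rewrite (vec_scale zeta_eq) veltZ.
exact: NZ (block0_bvec t).
Qed.

Lemma Msoc_block : Msoc k = block 0.
Proof.
apply/seteqP; split=> [q|_ [c c0 <-]].
  apply; split; first by apply/scalars_ksub/block_ksub.
  move=> _ [b Bb [m _ <-]]; rewrite tens_ket /flin scaler_sumr.
  apply: (@ksub_sum k W (block 0) _ _ _ _ (block_ksub 0)) => t _.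
  have [_ _ NZ] := block_ksub 0; rewrite kactAr; apply: NZ; rewrite -tens1.
  exact: Bdeg_block0.
move=> N [/scalars_ksub kN NG]; have [N0 ND NZ] := kN; rewrite /comb velt_sum.
apply: (@ksub_sum k W N _ _ _ _ kN) => i _; rewrite veltZ.
have [/isig0_surj[t <-]|/c0 ->] := eqVneq (blk i) 0%N; last by rewrite kact0l.
apply: NZ; apply: NG; rewrite val_isig // add0n.
pose s := [:: decT 0; decT 1; decT 0; decT 2].
exists (\prod_(u <- s) X k u); first by move=> B [_ BG]; apply: BG; exists (in_tuple s).
exists (ket k t); first by [].
rewrite tens_prodX.
have /allP/(_ _ (encT_transps t))/(seqvP zeta) <- := check_top.
by rewrite /s /= !encT_decT.
Qed.

End Submodules.

(** * The head *)

Section Head.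
Variables (k : fieldType) (zeta : k) (zeta_prim : 3.-primitive_root zeta).
Hypothesis three_neq0 : 3 != 0 :> k.
Let zeta_eq := prim3_eq zeta_prim.
Local Notation vec := (vec zeta).
Local Notation Mp := (Mp zeta).
Local Notation block := (block zeta).
Local Notation soc := (soc zeta).
Local Notation W := (verma (Msigma k)).
Local Notation velt := (@velt k).

Lemma Mp_coef p (v : 'cV[k]_36) i : (Mp p *m v) i 0 =
  \sum_(j < 36) v j 0 * phi zeta (scoef (papp p [:: (z1, j : nat)]) i).
Proof.
rewrite {1}(col_sum v) mulmx_sumr summxE; apply: eq_bigr => j _.
by rewrite -scalemxAr mxE -(vece zeta) (Mp_vec zeta_eq) vec_coef.
Qed.

(** If |b> occurs in v, a rescaled [qrot b c] yields an element of N whose degree 0 part is exactly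
    |c>; its parts of higher degree are not controlled. *)
Lemma submod_proj (N : set W) (v : 'cV[k]_36) (b c : nat) :
  submod setT N -> (b < 3)%N -> (c < 3)%N ->
  N (velt v) -> v (inord b) 0 != 0 ->
  exists u, N (velt u) /\ forall c', (c' < 3)%N -> u (inord c') 0 = (c' == c)%:R.
Proof.
move=> sN b3 c3 Nv vb.
have mem3 x : (x < 3)%N -> x \in transps by rewrite mem_iota.
have /allP/(_ _ (mem3 b b3))/allP/(_ _ (mem3 c c3))/andP[vq /allP cq] := check_qrot.
have [_ _ NZ] := submodT_ksub sN.
exists ((v (inord b) 0)^-1 *: (Mp (qrot b c) *m v)); split.
  by rewrite veltZ; apply: NZ (submod_Mp zeta_eq sN vq Nv).
move=> c' c'3; rewrite mxE Mp_coef.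
have lt36 (x : nat) : (x < 3)%N -> (x < 36)%N by move/leq_trans; apply.
have cqj (j : 'I_36) : scoef (papp (qrot b c) [:: (z1, j : nat)]) (inord c' : 'I_36)
    = if ((j : nat) == b) && (c' == c) then z1 else z0.
  rewrite inordK ?lt36 //.
  have /cq/allP/(_ _ (mem3 c' c'3))/eqP : (j : nat) \in iota 0 36.
    by rewrite mem_iota ltn_ord.
  by [].
under eq_bigr do rewrite cqj.
rewrite (bigD1 (inord b)) //= inordK ?lt36 // eqxx big1 => [|j jb]; last first.
  have -> : (j == b :> nat) = false.
    by apply/eqP => e; case/eqP: jb; apply: val_inj; rewrite /= inordK ?lt36.
  by rewrite phi_0 mulr0.
by rewrite addr0 /=; case: eqP => _; rewrite ?phi_1 ?phi_0 ?mulr1 ?mulr0 // mulVf.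
Qed.

(** Nakayama made explicit, by downward induction on the index j: the word of index j applied to an
    element with degree 0 part |j mod 3> gives e_j plus later basis vectors, which are already in
    N. *)
Lemma submod_full (N : set W) (v : 'cV[k]_36) (b : nat) : submod setT N -> (b < 3)%N ->
  N (velt v) -> v (inord b) 0 != 0 -> N = setT.
Proof.
move=> sN b3 Nv vb; have [_ ND NZ] := submodT_ksub sN.
have Ne n (j : 'I_36) : (36 <= n + j)%N -> N (velt (e_ k j)).
  elim: n j => [|n IH] j; first by case/idPn; rewrite add0n -ltnNge ltn_ord.
  move=> jn.
  have m3 : (j %% 3 < 3)%N by rewrite ltn_mod.
  have [u [Nu u3]] := submod_proj sN b3 m3 Nv vb.
  have /allP/(_ j) := check_qword; rewrite mem_iota ltn_ord => /(_ isT).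
  case/andP=> /andP[vq /(seqvP zeta) e1] /allP e2.
  pose x := Mp (qword j) *m u.
  have Nx : N (velt x) by apply: (submod_Mp zeta_eq sN vq Nu).
  (* Up to the index j only the degree 0 part of u contributes, by the last part of
     [check_qword]. *)
  have xi (i : 'I_36) : (i <= j)%N -> x i 0 = (i == j)%:R.
    move=> ij; rewrite /x Mp_coef.
    have m36 : (j %% 3 < 36)%N by apply: leq_trans m3 _.
    rewrite (bigD1 (inord (j %% 3))) //= big1 => [|l lj].
      rewrite addr0 u3 // eqxx mul1r inordK // -vec_coef e1 vece mxE.
      by [].
    have [l3|l3] := ltnP l 3.
      have := u3 _ l3; rewrite inord_val => ->.
      case: eqP => [e|_]; last by rewrite mul0r.
      by case/eqP: lj; apply: val_inj; rewrite /= inordK.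
    have /e2/allP/(_ i) : (l : nat) \in iota 3 33 by rewrite mem_iota l3 ltn_ord.
    by rewrite mem_iota ltnS ij => /(_ isT)/eqP ->; rewrite phi_0 mulr0.
  have -> : e_ k j = x + \sum_(i < 36 | (j < i)%N) (- x i 0) *: e_ k i.
    rewrite {1}(col_sum x) (bigID (fun i : 'I_36 => (j < i)%N)) /= addrAC -big_split /=.
    rewrite big1 ?add0r => [|i _]; last by rewrite scaleNr subrr.
    rewrite (bigD1 j) ?ltnn //= big1 ?addr0 => [|i /andP[ij ne]].
      by rewrite xi // eqxx scale1r.
    by rewrite xi 1?leqNgt // (negPf ne) scale0r.
  rewrite veltD velt_sum; apply: (ND _ _ Nx).
  apply: (@ksub_sum k W N _ _ _ _ (submodT_ksub sN)) => i ji; rewrite veltZ; apply: (NZ).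
  by apply: IH; move: jn ji (ltn_ord j); clear; lia.
apply/seteqP; split=> // q _; have [u ->] := velt_surj zeta_eq q.
rewrite (col_sum u) velt_sum.
apply: (@ksub_sum k W N _ _ _ _ (submodT_ksub sN)) => i _; rewrite veltZ; apply: (NZ).
by apply: (Ne 36%N).
Qed.

Lemma blockR_Y t u : block 3 u -> Y k t *: u = 0.
Proof.
move=> [c cB <-]; rewrite /comb velt_sum scaler_sumr; apply: big1 => i _.
have [/isig7_surj[x <-]|/cB ->] := eqVneq (blk i) 3%N; last first.
  by rewrite scale0r velt0 scaler0.
rewrite veltZ kactAr val_isig // (slin_Y zeta_eq).
have /allP/(_ _ (encT_transps t))/allP/(_ _ (encT_transps x))/(seqvP zeta) -> := check_Yr.
by rewrite [vec _]big_nil velt0 kact0r.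
Qed.

Lemma blockR_iso : ds_iso (block 3) (Msigma k).
Proof.
exact: (@block_iso k zeta zeta_eq three_neq0 (Msigma k) _ _ (@isig_inj 7 isT)
  blk_isig7 isig7_surj
  (sigma_G zeta_eq (o := 7) isT) (sigma_D zeta_eq (o := 7) isT)).
Qed.
Lemma block0_iso : ds_iso (block 0) (Msigma k).
Proof.
exact: (@block_iso k zeta zeta_eq three_neq0 (Msigma k) _ _ (@isig_inj 0 isT)
  blk_isig0 isig0_surj
  (sigma_G zeta_eq (o := 0) isT) (sigma_D zeta_eq (o := 0) isT)).
Qed.
Lemma blockN_iso l : l \in [:: 1; 2]%N -> ds_iso (block l) (Mtau zeta_prim l).
Proof.
move=> l12.
exact: (@block_iso k zeta zeta_eq three_neq0 (Mtau zeta_prim l) _ _ (itau_inj l12)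
  (fun b => blk_itau b l12) (fun i => itau_surj l12) (tau_G l12) (tau_D l12)).
Qed.

Lemma blockR_neq0 : bvec zeta (M := Msigma k) (isig 7) t23 <> 0.
Proof.
rewrite -(velt0 k) => /(velt_inj zeta_eq)/(congr1 (lam zeta 8)).
rewrite val_isig // encT_t23 (lam_vec zeta_eq) lam0.
have /allP/(_ 8)/(_ isT)/allP/(_ 8)/(_ isT)/eqP -> := check_dual.
by rewrite phi_3; apply/eqP.
Qed.

Lemma blockR_bvec t : block 3 (bvec zeta (M := Msigma k) (isig 7) t).
Proof. exact: (bvec_block zeta (M := Msigma k) (@isig_inj 7 isT) blk_isig7 isig7_surj). Qed.

(** The submodule generated by R is nonzero and therefore contains the socle. *)
Lemma soc_highest_weight : highest_weight (Msigma k) soc.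
Proof.
exists (block 3); split.
- exact: (@block_DS3 k zeta (Msigma k) _ _ (@isig_inj 7 isT) blk_isig7 isig7_surj
    (sigma_G zeta_eq (o := 7) isT) (sigma_D zeta_eq (o := 7) isT)).
- exact: blockR_iso.
- exact: blockR_Y.
have GR : genmod setT (block 3) (bvec zeta (M := Msigma k) (isig 7) t23).
  by move=> N [_ NG]; apply: NG; apply: blockR_bvec.
apply/seteqP; split=> [q|].
  apply; split; first exact: (soc_submod zeta_eq three_neq0).
  exact: block_sub_soc.
apply: (submod_soc zeta_eq); first exact: submod_genmod.
by move=> e; move: GR; rewrite e; apply: blockR_neq0.
Qed.

(** The coordinate of |12> vanishes on every proper submodule, hence on N + K, which is then proper;
    maximality gives N + K = N. *)
Lemma max_proper N : maximal_submod N ->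
  forall K : set W, submod setT K -> K <> setT -> K `<=` N.
Proof.
move=> [sN Nprop Nmax] K sK Kprop.
have coord0 (P : set W) v : submod setT P -> P <> setT -> P (velt v) -> v (inord 0) 0 = 0.
  move=> sP PT Pv; apply/eqP; apply: contrapT => /negP v0.
  by apply: PT; apply: (@submod_full P v 0 sP).
pose S := [set q : W | exists a b, [/\ N a, K b & q = a + b]].
have [N0 ND NZ] := sN; have [K0 KD KZ] := sK.
have sS : submod setT S.
  split; first by exists 0, 0; rewrite addr0.
    move=> _ _ [a [b [Na Kb ->]]] [c [d [Nc Kd ->]]]; exists (a + c), (b + d).
    by split; [apply: ND|apply: KD|rewrite addrACA].
  move=> x _ xK [a [b [Na Kb ->]]]; exists (x *: a), (x *: b).
  by split; [apply: NZ|apply: KZ|rewrite scalerDr].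
have [a Na|<-|ST] := Nmax S sS; last 1 first.
- have : S (velt (e_ k (inord 0 : 'I_36))) by rewrite ST.
  move=> [a [b [Na Kb]]].
  have [v ev] := velt_surj zeta_eq a; have [w ew] := velt_surj zeta_eq b.
  rewrite ev ew -veltD => /(velt_inj zeta_eq)/(congr1 (fun x : 'cV[k]_36 => x (inord 0) 0)).
  rewrite !mxE eqxx (coord0 N v) ?(coord0 K w) -?ev -?ew // addr0 => /eqP.
  by rewrite oner_eq0.
- by exists a, 0; rewrite addr0.
by move=> b Kb; exists 0, b; rewrite add0r.
Qed.

Lemma soc_head : submod_iso soc (headmod W).
Proof.
have [f fE] := @verma_lift k (Msigma k) W (@bvec k zeta (Msigma k) (isig 7))
  (sigma_G zeta_eq (o := 7) isT) (sigma_D zeta_eq (o := 7) isT)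
  (fun t u => blockR_Y t (blockR_bvec u)).
have fD u v : f (u + v) = f u + f v by exact: linearD.
have fB u v : f (u - v) = f u - f v by exact: linearB.
have fZ a u : f (a *: u) = a *: f u by exact: linearZ_LR.
have f0 : f 0 = 0 by exact: linear0.
pose K := [set q : W | f q = 0].
have sK : submod setT K.
  split=> [|u v|a u _] /=; first exact: f0.
    by rewrite /K /= fD => -> ->; rewrite addr0.
  by rewrite /K /= fZ => ->; rewrite scaler0.
have image_submod (N : set W) : submod setT N -> submod setT (f @` N).
  move=> [N0 ND NZ]; split; first by exists 0; rewrite ?f0.
    by move=> _ _ [u Nu <-] [v Nv <-]; exists (u + v); [apply: ND|rewrite fD].
  by move=> a _ _ [u Nu <-]; exists (a *: u); [apply: NZ|rewrite fZ].
have f_soc q : soc (f q).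
  have [u ->] := verma_span q; rewrite linear_sum.
  apply: (@ksub_sum k W soc _ _ _ _ (soc_ksub zeta)) => b _.
  have [_ _ SZ] := soc_submod zeta_eq three_neq0.
  rewrite fZ; apply: (SZ) => //; rewrite fE scale1r flin_ket.
  exact: (block_sub_soc (blockR_bvec b)).
have soc_f (N : set W) : submod setT N -> ~ (N `<=` K) -> soc `<=` f @` N.
  move=> sN NK; apply: (submod_soc zeta_eq); first exact: image_submod.
  move=> e; apply: NK => q Nq; have : (f @` N) (f q) by exists q.
  by rewrite e.
have K_proper : K <> setT.
  move=> KT; have : K (@tens k (Msigma k) 1 (ket k t23)) by rewrite KT.
  rewrite /K /= fE scale1r flin_ket; apply: blockR_neq0.
have Kmax : maximal_submod K.
  split=> // N sN KN; have [NK|NK] := EM (N `<=` K).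
    by left; apply/seteqP; split.
  (* The image of N is nonzero and so contains the whole socle; thus q differs from some n in N by
     an element of the kernel K. *)
  right; apply/seteqP; split=> // q _; have [n Nn en] := soc_f N sN NK _ (f_soc q).
  have [_ ND _] := sN; rewrite -(subrK n q); apply: ND => //; apply: KN.
  by rewrite /K /= fB en subrr.
(* K is itself maximal and lies in every maximal submodule. *)
have radE : radical W = K.
  apply/seteqP; split=> [q|q Kq N maxN]; first by apply.
  exact: (max_proper maxN sK K_proper).
have [|g gE] := @lquot_lift _ _ _ (radical W) f; first by move=> u; rewrite radE.
exists g; split=> [p q|].
  have [u ->] := lpi_surj p; have [v ->] := lpi_surj q; rewrite !gE => e.
  apply/lpiP => N [_]; apply; rewrite radE /K /=.
  by rewrite fB e subrr.
apply/seteqP; split=> [_ [p _ <-]|q].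
  by have [u ->] := lpi_surj p; rewrite gE; apply: f_soc.
have sT : submod setT [set: W] by split.
have TK : ~ ([set: W] `<=` K) by move=> TK; apply: K_proper; apply/seteqP; split.
move=> /(soc_f _ sT TK)[u _ <-]; exists (lpi (radical W) u) => //; exact: gE.
Qed.
End Head.

(** * Direct sum decomposition and conclusion *)

Lemma soc_dsum (k : fieldType) (zeta : k) :
  zeta ^+ 2 = - 1 - zeta -> 3 != 0 :> k ->
  dsum (fun B : 'I_4 => block zeta B) (soc zeta).
Proof.
move=> zeta_eq three_neq0; split.
  apply/seteqP; split=> [_ [c _ <-]|_ [f fB <-]]; last first.
    apply: (@ksub_sum k _ (soc zeta) _ _ _ _ (soc_ksub zeta)) => B _.
    exact: (block_sub_soc (fB B)).
  have blk4 (i : 'I_10) : (blk i < 4)%N.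
    by rewrite /blk; do 2! [case: ifP => // _]; case: ifP.
  exists (fun B : 'I_4 => velt (comb zeta (fun i => if blk i == B then c i else 0))).
    by move=> B; exists (fun i : 'I_10 => if blk i == B then c i else 0) => // i /negPf ->.
  rewrite -velt_sum; congr velt; rewrite /comb exchange_big /=; apply: eq_bigr => i _.
  rewrite -scaler_suml (bigD1 (Ordinal (blk4 i))) //= eqxx big1 ?addr0 // => B.
  by rewrite -val_eqE /= eq_sym => /negPf ->.
move=> f fB f0.
have /choice[c cP] : forall B : 'I_4, exists c : 'I_10 -> k,
    (forall i : 'I_10, blk i != B -> c i = 0) /\ f B = velt (comb zeta c).
  by move=> B; have [c cB <-] := fB B; exists c.
have e : comb zeta (fun i => \sum_B c B i) = comb zeta (fun=> 0).
  apply: (velt_inj zeta_eq); rewrite comb0 velt0 -f0.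
  under [RHS]eq_bigr do rewrite (cP _).2; rewrite -velt_sum; congr velt.
  by rewrite /comb exchange_big; apply: eq_bigr => i _; rewrite scaler_suml.
move=> B; rewrite (cP B).2 /comb big1 ?velt0 // => i _.
have [bi|/(cP B).1 ->] := eqVneq (blk i) B; last by rewrite scale0r.
have := comb_inj zeta_eq three_neq0 e i; rewrite (bigD1 B) //= big1 => [|B' BB'].
  by rewrite addr0 => ->; rewrite scale0r.
by apply: (cP B').1; rewrite bi eq_sym.
Qed.

Theorem lemma20 (k : closedFieldType) (k_char0 : [pchar k] =i pred0)
    (zeta : k) (zeta_prim : 3.-primitive_root zeta) :
  let S : set (verma (Msigma k)) := socle (verma (Msigma k)) in
  let L := headmod (verma (Msigma k)) in
  [/\ dsum (tnth [tuple Msoc k; Nmod zeta 1; Nmod zeta 2; Rmod k]) S,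
      [/\ ds_iso (Msoc k) (Msigma k), ds_iso (Rmod k) (Msigma k),
          ds_iso (Nmod zeta 1) (Mtau zeta_prim 1)
        & ds_iso (Nmod zeta 2) (Mtau zeta_prim 2)],
      highest_weight (Msigma k) S
    & submod_iso S L].
Proof.
move=> S L; have zeta_eq := prim3_eq zeta_prim.
have three_neq0 : 3 != 0 :> k.
  by apply/negP => e; have := k_char0 3%N; rewrite !inE /= e.
rewrite /S (socleE zeta_eq three_neq0) (Msoc_block zeta_prim) (Rmod_block zeta_prim).
rewrite (Nmod_block zeta_prim (l := 1)) // (Nmod_block zeta_prim (l := 2)) //.
split; last exact: (soc_head zeta_prim three_neq0).
- have -> : tnth [tuple block zeta 0; block zeta 1; block zeta 2; block zeta 3] =
      fun B : 'I_4 => block zeta B.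
    by apply: funext => B; case: B => -[|[|[|[|//]]]].
  exact: soc_dsum.
- split; [exact: block0_iso|exact: blockR_iso|exact: blockN_iso|exact: blockN_iso].
exact: soc_highest_weight.
Qed.
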